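(* Let $\Sigma$ be a finite set of full dependencies that is CQ-FO-rewritable. Then, for databases $\mathcal{D},\mathcal{D}'$ given as input, deciding whether $\mathcal{D}'$ is a repair of $\langle\Sigma,\mathcal{D}\rangle$ is in $\mathrm{AC}^0$ with respect to data complexity.
   Context: A signature is a set of predicate symbols with arities, always containing a special 0-ary predicate $\bot$. A term is a constant or a variable; a (predicate) atom is $p(t_1,\dots,t_n)$; an inequality is $t\neq t'$. A database is a finite set of ground atoms (facts) not containing $\bot$. A conjunction with inequalities is a conjunction of at least one predicate atom or inequality. A conjunctive query (CQ) is $\exists\vec y\,\gamma$ with $\gamma$ a conjunction with inequalities (its free variables are those not in $\vec y$); a UCQ is a finite disjunction of CQs. A dependency is a first-order sentence $\forall\vec x\,(\gamma\rightarrow Q)$ where $\gamma$ (the body) is a conjunction with inequalities whose variables are in $\vec x$, each occurring in some predicate atom of $\gamma$, and $Q$ (the head) is a UCQ whose free variables are among $\vec x$ and in which every existentially quantified variable of each disjunct occurs in a predicate atom of that disjunct. A dependency is full if its head is a single CQ (no disjunction) all of whose variables occur in the body. $\mathcal{D}$ is consistent with $\Sigma$ if $\mathcal{D}$ satisfies every dependency of $\Sigma$. A repair of $\langle\Sigma,\mathcal{D}\rangle$ is an inclusion-maximal subset of $\mathcal{D}$ consistent with $\Sigma$. $\Sigma$ is CQ-FO-rewritable if classical conjunctive query answering over $\Sigma$ is first-order rewritable: for every CQ $q(\vec x)$ there is a first-order query $\phi_q(\vec x)$ such that for every database $\mathcal{D}$ and every tuple of constants $\vec t$, $q(\vec t)$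 is true in every model of $\mathcal{D}\cup\Sigma$ (classical first-order entailment) iff $\mathcal{D}\models\phi_q(\vec t)$. Data complexity: $\Sigma$ fixed, databases are the input.
   Formalization: Models of D ∪ Σ in the definition of CQ-FO-rewritability are taken under the unique name assumption (distinct constants denote distinct elements), without which the claim fails; the signature is finite and AC^0 is the non-uniform class. *)

(* Defs.v *)
From Stdlib Require List.
From mathcomp Require Import all_boot.
Set Implicit Arguments.
Unset Strict Implicit.
Unset Printing Implicit Defensive.

Record signature := Signature {
  sym : finType;
  arity : sym -> nat;
  bot : sym;
  arity_bot : arity bot = 0 }.

Inductive term := TConst of nat | TVar of nat.

Section Syntax.
Variable S : signature.

Record atom := Atom { apred : sym S; aargs : seq term }.

Inductive literal := LAtom of atom | LNeq of term & term.

Definition conj := seq literal.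

(* A CQ  exists ys, gamma : its free variables are those of gamma not in ys. *)
Record cq := CQ { cq_ex : seq nat; cq_body : conj }.

(* A dependency  forall xs (gamma -> Q)  with Q a UCQ (list of disjuncts). *)
Record dependency := Dep { dbody : conj; dhead : seq cq }.

Record fact := Fact { fpred : sym S; fargs : seq nat }.
Definition database := seq fact.

Definition term_vars (t : term) : seq nat :=
  if t is TVar x then [:: x] else [::].
Definition atom_vars (a : atom) : seq nat := flatten (map term_vars (aargs a)).
Definition lit_vars (l : literal) : seq nat :=
  match l with LAtom a => atom_vars a | LNeq t u => term_vars t ++ term_vars u end.
Definition conj_vars (g : conj) : seq nat := flatten (map lit_vars g).
Definition conj_atom_vars (g : conj) : seq nat :=
  flatten (map (fun l => if l is LAtom a then atom_vars a else [::]) g).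
Definition cq_fv (q : cq) : seq nat :=
  [seq x <- conj_vars (cq_body q) | x \notin cq_ex q].

Definition wf_atom (a : atom) : bool := size (aargs a) == arity (apred a).
Definition wf_conj (g : conj) : bool :=
  ~~ nilp g && all (fun l => if l is LAtom a then wf_atom a else true) g.
Definition wf_cq (q : cq) : bool := wf_conj (cq_body q).
Definition wf_fact (f : fact) : bool :=
  (size (fargs f) == arity (fpred f)) && (fpred f != @bot S).
Definition wf_db (D : database) : bool := all wf_fact D.

(* READING: the universally quantified variables xs of a dependency are the
   variables of its body. *)
Definition wf_dep (d : dependency) : bool :=
  [&& wf_conj (dbody d),
      all (fun x => x \in conj_atom_vars (dbody d)) (conj_vars (dbody d)),
      ~~ nilp (dhead d) &
      all (fun q => [&& wf_cq q,
                     all (fun x => x \in conj_vars (dbody d)) (cq_fv q) &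
                     all (fun y => y \in conj_atom_vars (cq_body q)) (cq_ex q)])
          (dhead d)].

Definition full (d : dependency) : bool :=
  match dhead d with
  | [:: q] => (cq_ex q == [::]) &&
              all (fun x => x \in conj_vars (dbody d)) (conj_vars (cq_body q))
  | _ => false
  end.

Record structure := Structure {
  dom : Type;
  cint : nat -> dom;
  rint : sym S -> seq dom -> Prop }.
Arguments cint : clear implicits.
Arguments rint : clear implicits.

Section Sem.
Variable M : structure.

Definition teval (v : nat -> dom M) (t : term) : dom M :=
  match t with TConst c => cint M c | TVar x => v x end.

(* bot is interpreted as falsity in every structure *)
Definition atom_holds (v : nat -> dom M) (a : atom) : Prop :=
  apred a <> @bot S /\ rint M (apred a) (map (teval v) (aargs a)).

Definition lit_holds (v : nat -> dom M) (l : literal) : Prop :=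
  match l with
  | LAtom a => atom_holds v a
  | LNeq t u => teval v t <> teval v u
  end.

Definition conj_holds (v : nat -> dom M) (g : conj) : Prop :=
  forall l, List.In l g -> lit_holds v l.

Definition cq_holds (v : nat -> dom M) (q : cq) : Prop :=
  exists v' : nat -> dom M,
    (forall x, x \notin cq_ex q -> v' x = v x) /\ conj_holds v' (cq_body q).

Definition dep_holds (d : dependency) : Prop :=
  forall v : nat -> dom M, conj_holds v (dbody d) ->
    exists2 q, List.In q (dhead d) & cq_holds v q.

Definition fact_holds (f : fact) : Prop :=
  rint M (fpred f) (map (cint M) (fargs f)).
End Sem.

Definition db_struct (D : database) : structure :=
  @Structure nat id (fun p args => List.In (Fact p args) D).

Definition consistent (Sig : seq dependency) (D : database) : Prop :=
  forall d, List.In d Sig -> dep_holds (db_struct D) d.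

Definition db_subset (D1 D2 : database) : Prop := forall f, List.In f D1 -> List.In f D2.

Definition is_repair (Sig : seq dependency) (D D' : database) : Prop :=
  [/\ db_subset D' D, consistent Sig D' &
      forall D'', wf_db D'' -> db_subset D' D'' -> db_subset D'' D ->
        consistent Sig D'' -> db_subset D'' D'].

(* Models of D u Sig (constants interpreted injectively: unique names). *)
Definition is_model (Sig : seq dependency) (D : database) (M : structure) : Prop :=
  [/\ injective (cint M),
      forall f, List.In f D -> fact_holds M f &
      forall d, List.In d Sig -> dep_holds M d].

Definition certain (Sig : seq dependency) (D : database) (q : cq) (h : nat -> nat) : Prop :=
  forall M : structure, is_model Sig D M -> cq_holds (fun x => cint M (h x)) q.

Inductive fo :=
  | FAtom of atom
  | FEq of term & term
  | FNot of fo
  | FAnd of fo & fo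
  | FEx of nat & fo.

Fixpoint fo_fv (phi : fo) : seq nat :=
  match phi with
  | FAtom a => atom_vars a
  | FEq t u => term_vars t ++ term_vars u
  | FNot p => fo_fv p
  | FAnd p q => fo_fv p ++ fo_fv q
  | FEx x p => [seq y <- fo_fv p | y != x]
  end.

Fixpoint fo_holds (M : structure) (v : nat -> dom M) (phi : fo) : Prop :=
  match phi with
  | FAtom a => atom_holds v a
  | FEq t u => teval v t = teval v u
  | FNot p => ~ fo_holds v p
  | FAnd p q => fo_holds v p /\ fo_holds v q
  | FEx x p => exists e : dom M,
      fo_holds (fun y => if y == x then e else v y) p
  end.

Definition wf_fo_atoms : fo -> bool :=
  fix w phi := match phi with
  | FAtom a => wf_atom a
  | FEq _ _ => true
  | FNot p => w p
  | FAnd p q => w p && w q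
  | FEx _ p => w p
  end.

Definition CQ_FO_rewritable (Sig : seq dependency) : Prop :=
  forall q : cq, wf_cq q ->
    exists phi : fo,
      wf_fo_atoms phi /\
      (forall x, x \in fo_fv phi -> x \in cq_fv q) /\
      forall (D : database) (h : nat -> nat), wf_db D ->
        (certain Sig D q h <-> fo_holds (M := db_struct D) h phi).

Fixpoint bin_aux (fuel n : nat) : seq bool :=
  match fuel with
  | 0 => [::]
  | fuel'.+1 => if n is 0 then [::] else odd n :: bin_aux fuel' n./2
  end.
Definition bin (n : nat) : seq bool := if n is 0 then [:: false] else bin_aux n n.

(* Alphabet {0,1,#,$} coded by two bits per symbol. *)
Definition s0 : seq bool := [:: false; false].
Definition s1 : seq bool := [:: false; true].
Definition shash : seq bool := [:: true; false].
Definition sdollar : seq bool := [:: true; true].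

Definition enc_nat (n : nat) : seq bool :=
  flatten [seq (if b then s1 else s0) | b <- bin n].

Definition enc_fact (f : fact) : seq bool :=
  enc_nat (enum_rank (fpred f)) ++
  flatten [seq shash ++ enc_nat c | c <- fargs f] ++ sdollar.

Definition enc_db (D : database) : seq bool := flatten (map enc_fact D).

Definition enc_pair (DD : database * database) : seq bool :=
  enc_db DD.1 ++ sdollar ++ enc_db DD.2.

End Syntax.

Inductive circuit (n : nat) : Type :=
  | CIn of 'I_n
  | CNot of circuit n
  | CAnd of seq (circuit n)
  | COr of seq (circuit n).

Fixpoint ceval (n : nat) (x : seq bool) (c : circuit n) : bool :=
  match c with
  | CIn i => nth false x i
  | CNot c' => ~~ ceval x c'
  | CAnd cs => all (fun c' => ceval x c') cs
  | COr cs => has (fun c' => ceval x c') cs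
  end.

Fixpoint csize (n : nat) (c : circuit n) : nat :=
  match c with
  | CIn _ => 1
  | CNot c' => (csize c').+1
  | CAnd cs => (sumn (map (fun c' => csize c') cs)).+1
  | COr cs => (sumn (map (fun c' => csize c') cs)).+1
  end.

Fixpoint cdepth (n : nat) (c : circuit n) : nat :=
  match c with
  | CIn _ => 0
  | CNot c' => (cdepth c').+1
  | CAnd cs => (foldr maxn 0 (map (fun c' => cdepth c') cs)).+1
  | COr cs => (foldr maxn 0 (map (fun c' => cdepth c') cs)).+1
  end.

Definition in_AC0 (A : Type) (Valid : A -> Prop) (enc : A -> seq bool)
    (P : A -> Prop) : Prop :=
  exists (d k : nat) (C : forall n, circuit n),
    (forall n, cdepth (C n) <= d /\ csize (C n) <= n ^ k + k) /\
    forall a, Valid a -> (ceval (enc a) (C (size (enc a))) = true <-> P a).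

(* Main.v *)
Require Import Defs.
From Stdlib Require Import Classical FunctionalExtensionality.
From mathcomp Require Import all_boot zify.
Set Implicit Arguments.
Unset Strict Implicit.
Unset Printing Implicit Defensive.

(** Since the dependencies are full, the facts entailed by [D' + f] and [Sig]
    form a least model, so [f] can be added to [D'] inside [D] iff no fact outside
    [D] is entailed; the entailment of [bot], which is never in [D], accounts for
    unsatisfiability.  Hence a consistent [D'] included in [D] is a repair iff for
    every [f] in [D] but not in [D'] some [g] outside [D] is entailed by [D' + f],
    and by rewritability applied to atomic queries this is a first-order property
    of the pair [(D, D')].
    First-order properties are evaluated by circuits whose quantifiers range over
    the positions of numbers in the input, the constants of the formula, and a few
    numbers too long to occur in the input; the latter suffice although the
    semantics quantifies over all of [nat], because elements outside the active
    domain can be swapped. *)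

(** * Uniformly bounded circuit families *)

(* The index type is arbitrary: only the depth and size bounds must be uniform
   in the index, so that reindexing, even by infinite types, is free. *)
Definition ac0 (I : Type) (F : I -> seq bool -> Prop) : Prop :=
  exists (d k : nat) (C : forall n, I -> circuit n), forall n i,
    [/\ cdepth (C n i) <= d, csize (C n i) <= (n + 2) ^ k &
        forall x, size x = n -> (ceval x (C n i) <-> F i x)].

Section Closure.
Variable I : Type.
Implicit Types (F G : I -> seq bool -> Prop).

Lemma leq_poly n a b : a <= b -> (n + 2) ^ a <= (n + 2) ^ b.
Proof. by apply: leq_pexp2l; rewrite addn2. Qed.

(** The base [n + 2] is at least 2 for every length, so one more unit in the exponent pays for an
    output gate. *)
Lemma ltn_poly n s k : s <= (n + 2) ^ k -> s < (n + 2) ^ k.+1.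
Proof.
move=> le_s; have ?: 0 < (n + 2) ^ k by rewrite expn_gt0 addn2.
rewrite expnS; nia.
Qed.

Lemma ac0_ext F G : (forall i x, F i x <-> G i x) -> ac0 F -> ac0 G.
Proof.
move=> FG [d [k [C CP]]]; exists d, k, C => n i.
have [dC sC eC] := CP n i; split=> // x sx.
by rewrite -FG; apply: eC.
Qed.

Lemma ac0_reindex J (f : J -> I) F : ac0 F -> ac0 (fun j => F (f j)).
Proof. by move=> [d [k [C CP]]]; exists d, k, (fun n j => C n (f j)). Qed.

(** A length predicate becomes a constant gate, an empty conjunction or disjunction, since the
    family may depend on [n] without restriction. *)
Lemma ac0_size (b : I -> nat -> bool) : ac0 (fun i x => b i (size x)).
Proof.
exists 1, 0, (fun n i => if b i n then CAnd [::] else COr [::]) => n i.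
by split=> [||x <-]; case: (b i _).
Qed.

Lemma ac0_bit (f : I -> nat) : ac0 (fun i x => nth false x (f i)).
Proof.
(* A position beyond the input yields the constant false, in accordance with the default of
   [nth]. *)
exists 1, 0, (fun n i => if insub (f i) is Some j then CIn j else COr [::]) => n i.
split=> [||x sx]; case: insubP => [j _ //= <- //|] //=.
by rewrite -sx -leqNgt => le_f; rewrite nth_default.
Qed.

Lemma ac0_not F : ac0 F -> ac0 (fun i x => ~ F i x).
Proof.
move=> [d [k [C CP]]]; exists d.+1, k.+1, (fun n i => CNot (C n i)) => n i.
have [dC sC eC] := CP n i; split=> //=; first exact: ltn_poly.
by move=> x sx; rewrite -(eC x sx); split=> /negP.
Qed.

(** The choice is made by the index when the circuit is built, so no gate is spent. *)
Lemma ac0_if (b : I -> bool) F G :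
  ac0 F -> ac0 G -> ac0 (fun i x => if b i then F i x else G i x).
Proof.
move=> [d [k [C CP]]] [d' [k' [C' CP']]].
exists (maxn d d'), (maxn k k'), (fun n i => if b i then C n i else C' n i).
move=> n i; have [dC sC eC] := CP n i; have [dC' sC' eC'] := CP' n i.
case: (b i); split=> //; rewrite ?leq_max ?dC ?dC' ?orbT //.
  by apply: leq_trans sC _; apply: leq_poly; apply: leq_maxl.
by apply: leq_trans sC' _; apply: leq_poly; apply: leq_maxr.
Qed.

Lemma depth_map n d (T : Type) (C : T -> circuit n) s :
  (forall j, cdepth (C j) <= d) ->
  foldr maxn 0 (map (@cdepth n) (map C s)) <= d.
Proof. by move=> dC; elim: s => //= j s IHs; rewrite geq_max dC IHs. Qed.

Lemma size_map_leq n b (T : Type) (C : T -> circuit n) s :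
  (forall j, csize (C j) <= b) ->
  sumn (map (@csize n) (map C s)) <= size s * b.
Proof. by move=> sC; elim: s => //= j s IHs; rewrite mulSn leq_add. Qed.

Lemma gate_bounds n d k e (T : Type) (C : T -> circuit n) s :
  (forall j, cdepth (C j) <= d) -> (forall j, csize (C j) <= (n + 2) ^ k) ->
  size s <= (n + 2) ^ e ->
  (foldr maxn 0 (map (@cdepth n) (map C s))).+1 <= d.+1 /\
  (sumn (map (@csize n) (map C s))).+1 <= (n + 2) ^ (e + k).+1.
Proof.
move=> dC sC le_s; split; first by rewrite ltnS; apply: depth_map.
apply: ltn_poly; apply: leq_trans (size_map_leq s sC) _.
by rewrite expnD leq_mul.
Qed.

(** One disjunction of unbounded fan-in. The list may depend on the index and the length but not on
    the input itself, and taking [j] into the index makes the bounds for the disjuncts uniform. *)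
Lemma ac0_exists (e : nat) (L : I -> nat -> seq nat)
    (F : I -> nat -> seq bool -> Prop) :
  (forall i n, size (L i n) <= (n + 2) ^ e) ->
  ac0 (fun ij : I * nat => F ij.1 ij.2) ->
  ac0 (fun i x => exists2 j, j \in L i (size x) & F i j x).
Proof.
move=> sL [d [k [C CP]]].
exists d.+1, (e + k).+1, (fun n i => COr [seq C n (i, j) | j <- L i n]) => n i.
have dC j : cdepth (C n (i, j)) <= d by have [] := CP n (i, j).
have sC j : csize (C n (i, j)) <= (n + 2) ^ k by have [] := CP n (i, j).
have [? ?] := gate_bounds dC sC (sL i n).
split=> //= x sx; rewrite has_map sx; split.
  move=> /hasP[j jL /= Cj]; exists j => //.
  by have [_ _ eC] := CP n (i, j); apply/eC.
move=> [j jL Fj]; apply/hasP; exists j => //=.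
by have [_ _ eC] := CP n (i, j); apply/eC.
Qed.

Lemma ac0_forall (e : nat) (L : I -> nat -> seq nat)
    (F : I -> nat -> seq bool -> Prop) :
  (forall i n, size (L i n) <= (n + 2) ^ e) ->
  ac0 (fun ij : I * nat => F ij.1 ij.2) ->
  ac0 (fun i x => forall j, j \in L i (size x) -> F i j x).
Proof.
move=> sL [d [k [C CP]]].
exists d.+1, (e + k).+1, (fun n i => CAnd [seq C n (i, j) | j <- L i n]) => n i.
have dC j : cdepth (C n (i, j)) <= d by have [] := CP n (i, j).
have sC j : csize (C n (i, j)) <= (n + 2) ^ k by have [] := CP n (i, j).
have [? ?] := gate_bounds dC sC (sL i n).
split=> //= x sx; rewrite all_map sx; split.
  move=> /allP Cj j jL; have [_ _ eC] := CP n (i, j).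
  by apply/eC => //; apply: Cj.
move=> Fj; apply/allP => j jL /=.
by have [_ _ eC] := CP n (i, j); apply/eC => //; apply: Fj.
Qed.

End Closure.

Section BooleanClosure.
Variable I : Type.
Implicit Types (F G : I -> seq bool -> Prop).

Lemma ac0_and F G : ac0 F -> ac0 G -> ac0 (fun i x => F i x /\ G i x).
Proof.
move=> acF acG.
(* A binary connective is a quantifier over the two indices 0 and 1. *)
pose H (i : I) j x := if j == 0 then F i x else G i x.
have acH : ac0 (fun ij : I * nat => H ij.1 ij.2).
  by apply: ac0_if; apply: ac0_reindex.
have sL (i : I) n : size [:: 0; 1] <= (n + 2) ^ 1 by rewrite expn1 leq_addl.
apply: ac0_ext (ac0_forall sL acH) => i x.
split=> [FG|[Fi Gi] j _]; last by rewrite /H; case: eqP.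
by split; [apply: (FG 0)|apply: (FG 1)].
Qed.

Lemma ac0_or F G : ac0 F -> ac0 G -> ac0 (fun i x => F i x \/ G i x).
Proof.
move=> acF acG.
pose H (i : I) j x := if j == 0 then F i x else G i x.
have acH : ac0 (fun ij : I * nat => H ij.1 ij.2).
  by apply: ac0_if; apply: ac0_reindex.
have sL (i : I) n : size [:: 0; 1] <= (n + 2) ^ 1 by rewrite expn1 leq_addl.
apply: ac0_ext (ac0_exists sL acH) => i x.
split=> [[j _]|[Fi|Gi]]; [|by exists 0|by exists 1].
by rewrite /H; case: eqP; [left|right].
Qed.

Lemma ac0_cond (f : I -> nat) F G : ac0 F -> ac0 G ->
  ac0 (fun i x => if nth false x (f i) then F i x else G i x).
Proof.
move=> acF acG; have acf := ac0_bit f.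
apply: ac0_ext (ac0_or (ac0_and acf acF) (ac0_and (ac0_not acf) acG)) => i x.
case: (nth false x (f i)); split.
- by case=> [[]|[]].
- by left.
- by case=> [[]|[]].
- by right.
Qed.

Lemma ac0_exists_lt (F : I -> nat -> seq bool -> Prop) :
  ac0 (fun ij : I * nat => F ij.1 ij.2) ->
  ac0 (fun i x => exists j, j < size x /\ F i j x).
Proof.
move=> acF.
have sL (i : I) n : size (iota 0 n) <= (n + 2) ^ 1.
  by rewrite expn1 size_iota leq_addr.
apply: ac0_ext (ac0_exists sL acF) => i x.
split=> [[j]|[j [lt_j Fj]]]; last by exists j; rewrite ?mem_iota.
by rewrite mem_iota => lt_j Fj; exists j.
Qed.

Lemma ac0_forall_lt (g : I -> nat) (F : I -> nat -> seq bool -> Prop) :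
  ac0 (fun ij : I * nat => F ij.1 ij.2) ->
  ac0 (fun i x => g i <= size x /\ forall j, j < g i -> F i j x).
Proof.
move=> acF.
(* The bound [g i] is arbitrary, so the list is cut at [n] to stay polynomial; the cut is void
   whenever [g i <= size x]. *)
have sL (i : I) n : size (iota 0 (minn (g i) n)) <= (n + 2) ^ 1.
  by rewrite expn1 size_iota (leq_trans (geq_minr _ _)) ?leq_addr.
apply: ac0_ext (ac0_and (ac0_size (fun i n => g i <= n))
                        (ac0_forall sL acF)) => i x.
split=> -[le_g allF]; split=> // j; have := allF j;
  by rewrite mem_iota /= add0n (minn_idPl le_g).
Qed.

End BooleanClosure.

(** * Symbols, words and tokens *)

Definition letter := (bool * bool)%type.
Definition bit_letter (b : bool) : letter := (false, b).
Definition hash : letter := (true, false).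
Definition dollar : letter := (true, true).

Definition spell (w : seq letter) : seq bool :=
  flatten [seq [:: s.1; s.2] | s <- w].

Definition letter_at (x : seq bool) (i : nat) : letter :=
  (nth false x i.*2, nth false x i.*2.+1).

Lemma letter_at_spell w i : letter_at (spell w) i = nth (false, false) w i.
Proof.
elim: w i => [|[a b] w IHw] [|i] //=; rewrite -?IHw /letter_at ?nth_nil //.
Qed.

(** Letters beyond the input read as [(false, false)], the digit 0, so a marker ([hash] or [dollar],
    the letters with true first component) certifies its position. Positions count letters and
    [size x] counts bits; this crude bound serves as the range of position quantifiers. *)
Lemma letter_at_lt x i : (letter_at x i).1 -> i < size x.
Proof.
move=> /=; case: (ltnP i (size x)) => // le_x.
by rewrite nth_default // -addnn (leq_trans le_x) ?leq_addr.
Qed.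

Section LetterFamilies.
Variable I : Type.

(** A letter takes four values, so two nested branchings on bits end in constants that depend on the
    index only. *)
Lemma ac0_letter (f : I -> nat) (P : I -> letter -> bool) :
  ac0 (fun i x => P i (letter_at x (f i))).
Proof.
pose const a b := ac0_size (fun i (_ : nat) => P i (a, b)).
pose low := fun i => (f i).*2.+1.
have := ac0_cond (fun i => (f i).*2)
  (ac0_cond low (const true true) (const true false))
  (ac0_cond low (const false true) (const false false)).
by apply: ac0_ext => i x; rewrite /letter_at /low; case: nth; case: nth.
Qed.

Lemma ac0_same_letter (f g : I -> nat) :
  ac0 (fun i x => letter_at x (f i) = letter_at x (g i)).
Proof.
pose is_letter s h := @ac0_letter h (fun _ t => t == s).
pose both s := ac0_and (is_letter s f) (is_letter s g).
have := ac0_or (ac0_or (both (true, true)) (both (true, false)))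
               (ac0_or (both (false, true)) (both (false, false))).
apply: ac0_ext => i x; case: (letter_at x (f i)) (letter_at x (g i)).
by move=> [] [] [[] []]; split=> //; intuition.
Qed.

End LetterFamilies.

(** * Binary expansions and their occurrences in the input *)

Definition unbin (s : seq bool) : nat := foldr (fun (b : bool) n => b + n.*2) 0 s.

Lemma bin_auxK f n : n <= f -> unbin (bin_aux f n) = n.
Proof.
elim: f n => [|f IHf] [|n] //= le_n; rewrite IHf; last by lia.
exact: (odd_double_half n.+1).
Qed.

Lemma binK : cancel bin unbin.
Proof. by case=> [|n] //; apply: bin_auxK. Qed.

Lemma bin_inj : injective bin. Proof. exact: can_inj binK. Qed.

Lemma unbin_lt s : unbin s < 2 ^ size s.
Proof. by elim: s => //= b s; rewrite expnS; case: b; lia. Qed.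

Lemma size_bin_gt0 n : 0 < size (bin n). Proof. by case: n. Qed.

Lemma ltn_bin n : n < 2 ^ size (bin n).
Proof. by rewrite -{1}(binK n) unbin_lt. Qed.

Definition word (n : nat) : seq letter := [seq bit_letter b | b <- bin n].

Lemma size_word n : size (word n) = size (bin n).
Proof. exact: size_map. Qed.

Lemma word_inj : injective word.
Proof. by move=> m n /inj_map eq_mn; apply: bin_inj; apply: eq_mn => a b []. Qed.

Lemma word_bit n r : r < size (word n) -> (nth (false, false) (word n) r).1 = false.
Proof. by rewrite size_word => lt_r; rewrite (nth_map false). Qed.

Definition occurs (x : seq bool) (i : nat) (u : seq letter) : Prop :=
  forall r, r < size u -> letter_at x (i + r) = nth (false, false) u r.

Lemma occurs_cat x i u v :
  occurs x i (u ++ v) <-> occurs x i u /\ occurs x (i + size u) v.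
Proof.
split=> [ouv|[ou ov] r].
  split=> r lt_r.
    by rewrite ouv ?nth_cat ?lt_r // size_cat ltn_addr.
  rewrite -addnA ouv ?size_cat ?ltn_add2l // nth_cat.
  by rewrite ltnNge leq_addr addKn.
rewrite size_cat nth_cat; case: (ltnP r (size u)) => [lt_r _|le_r lt_r]; first exact: ou.
by rewrite -ov; [rewrite -addnA subnKC|rewrite ltn_subLR].
Qed.

Lemma occurs1 x i s : occurs x i [:: s] <-> letter_at x i = s.
Proof.
split=> [/(_ 0 isT)|<- [|r] //]; by rewrite addn0.
Qed.

Lemma occurs_spell A u B : occurs (spell (A ++ u ++ B)) (size A) u.
Proof.
move=> r lt_r; rewrite letter_at_spell nth_cat ltnNge leq_addr addKn.
by rewrite nth_cat lt_r.
Qed.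

(* Domain elements as seen by a circuit: a known number, or the number whose
   binary expansion starts at a given letter of the input. *)
Inductive token := Named of nat | At of nat.

(** The marker required behind the digits delimits the number; otherwise words that are prefixes of
    the digit string would count as well. *)
Definition denotes (x : seq bool) (t : token) (c : nat) : Prop :=
  match t with
  | Named c' => c' = c
  | At j => occurs x j (word c) /\ (letter_at x (j + size (word c))).1
  end.

(** For [At j] the digits are compared in place, up to the marker that ends the number at [j], so
    that the value behind a position is never computed. *)
Definition segment (x : seq bool) (t : token) (i l : nat) : Prop :=
  match t with
  | Named c => l = size (word c) /\ occurs x i (word c)
  | At j => (forall r, r < l -> ~~ (letter_at x (i + r)).1 /\
                letter_at x (i + r) = letter_at x (j + r)) /\
            (letter_at x (j + l)).1
  end.

Definition bsegment x t i l := l <= size x /\ segment x t i l.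

(** No digit is a marker, so the marker fixes the length of the word; words of equal length at the
    same place agree, and [word] is injective. *)
Lemma denotes_At_inj x j c c' :
  denotes x (At j) c -> denotes x (At j) c' -> c = c'.
Proof.
move=> [oc ec] [oc' ec']; apply: word_inj.
have eq_sz : size (word c) = size (word c').
  apply/eqP; rewrite eqn_leq; apply/andP; split; rewrite leqNgt; apply/negP=> lt.
    by move: ec'; rewrite oc // word_bit.
  by move: ec; rewrite oc' // word_bit.
apply: (@eq_from_nth _ (false, false)) => // r lt_r.
by rewrite -oc // -oc' // -eq_sz.
Qed.

Lemma segmentP x t c i l : denotes x t c ->
  segment x t i l <-> l = size (word c) /\ occurs x i (word c).
Proof.
case: t => [c' <- //|j [oc ec]]; split=> [[eq_l el]|[-> oi]]; last first.
  split=> // r lt_r; split; first by rewrite oi // word_bit.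
  by rewrite oi // oc.
have sz_l : l = size (word c).
  apply/eqP; rewrite eqn_leq; apply/andP; split; rewrite leqNgt; apply/negP=> lt.
    by have [] := eq_l _ lt => nb eq; move: nb; rewrite eq ec.
  by move: el; rewrite oc // word_bit.
by split=> // r lt_r; rewrite -oc //; have [] := eq_l r; rewrite ?sz_l.
Qed.

Lemma size_word_lt x j c : denotes x (At j) c -> size (word c) < size x.
Proof. by move=> [_ /letter_at_lt]; apply: leq_ltn_trans; apply: leq_addl. Qed.

(** Equality of numbers is equality of their words, that is, agreement letter by letter up to a
    common end. *)
Definition token_eq_at x j t : Prop :=
  exists l, l < size x /\ (bsegment x t j l /\ (letter_at x (j + l)).1).

Definition token_eq (x : seq bool) (t u : token) : Prop :=
  match t, u with
  | Named c, Named c' => c = c'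
  | At j, _ => token_eq_at x j u
  | Named _, At j => token_eq_at x j t
  end.

Lemma token_eq_atP x j t c c' : denotes x (At j) c -> denotes x t c' ->
  token_eq_at x j t <-> c = c'.
Proof.
move=> dj dt; split=> [[l [_ [[_ /(segmentP _ _ dt)[-> oc'] el]]]]|eq_c].
  by apply: denotes_At_inj dj _; split.
rewrite -eq_c in dt.
have lt_c := size_word_lt dj; have [oc ec] := dj.
exists (size (word c)); do !split=> //; first exact: ltnW.
by apply/(segmentP _ _ dt).
Qed.

Lemma token_eqP x t u c c' : denotes x t c -> denotes x u c' ->
  token_eq x t u <-> c = c'.
Proof.
case: t => [a|j] dt; last exact: token_eq_atP.
case: u => [b|j] du /=; first by rewrite dt du.
by split=> [/(token_eq_atP du dt)|?] //; apply/(token_eq_atP du dt).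
Qed.

Definition word_args (cs : seq nat) : seq letter :=
  flatten [seq hash :: word c | c <- cs] ++ [:: dollar].

Fixpoint args_at (x : seq bool) (i : nat) (ts : seq token) : Prop :=
  if ts is t :: ts' then
    letter_at x i = hash /\
    exists l, l < size x /\ (bsegment x t i.+1 l /\ args_at x (i.+1 + l) ts')
  else letter_at x i = dollar.

Lemma word_args_cons c cs :
  word_args (c :: cs) = [:: hash] ++ word c ++ word_args cs.
Proof. by rewrite /word_args /= catA. Qed.

Lemma occurs_args_cons x i c cs :
  occurs x i (word_args (c :: cs)) <->
  letter_at x i = hash /\
  (occurs x i.+1 (word c) /\ occurs x (i.+1 + size (word c)) (word_args cs)).
Proof. by rewrite word_args_cons !occurs_cat occurs1 addn1. Qed.

Lemma occurs_args_head x i cs : occurs x i (word_args cs) -> (letter_at x i).1.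
Proof.
case: cs => [/occurs1 ->|c cs] //.
by rewrite occurs_args_cons => -[->].
Qed.

Fixpoint denote_all (x : seq bool) (ts : seq token) (cs : seq nat) : Prop :=
  match ts, cs with
  | [::], [::] => True
  | t :: ts', c :: cs' => denotes x t c /\ denote_all x ts' cs'
  | _, _ => False
  end.

Lemma args_atP x i ts cs : denote_all x ts cs ->
  args_at x i ts <-> occurs x i (word_args cs).
Proof.
elim: ts cs i => [|t ts IHts] [|c cs] i //= => [_|[dt dts]].
  by rewrite occurs1.
rewrite occurs_args_cons; split=> [[-> [l [_ [[_ /(segmentP _ _ dt)[-> oc]]]]]]|].
  by move/(IHts cs _ dts).
move=> [-> [oc ocs]]; split=> //.
have lt_x : size (word c) < size x.
  apply: leq_ltn_trans (letter_at_lt (occurs_args_head ocs)); exact: leq_addl.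
exists (size (word c)); do !split=> //; first exact: ltnW.
  by apply/(segmentP _ _ dt).
by apply/(IHts cs).
Qed.

(** Unique readability: [hash] or [dollar] decides whether an argument follows, and [denotes_At_inj]
    determines it. *)
Lemma occurs_args_inj x i cs cs' :
  occurs x i (word_args cs) -> occurs x i (word_args cs') -> cs = cs'.
Proof.
elim: cs cs' i => [|c cs IHcs] [|c' cs'] i //.
- by move=> /occurs1 ei /occurs_args_cons[]; rewrite ei.
- by move=> /occurs_args_cons[ei _] /occurs1; rewrite ei.
move=> /occurs_args_cons[_ [oc ocs]] /occurs_args_cons[_ [oc' ocs']].
have eq_c : c = c'.
  by apply: (@denotes_At_inj x i.+1); split=> //; apply: occurs_args_head; eassumption.
by rewrite -eq_c in ocs' *; rewrite (IHcs _ _ ocs ocs').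
Qed.

(** * Circuits comparing tokens and argument lists *)

Section TokenFamilies.
Variable I : Type.

Lemma ac0_token_case (tk : I -> token) (A B : I -> nat -> seq bool -> Prop) :
  ac0 (fun ij : I * nat => A ij.1 ij.2) ->
  ac0 (fun ij : I * nat => B ij.1 ij.2) ->
  ac0 (fun i x => match tk i with Named c => A i c x | At j => B i j x end).
Proof.
pose named t := if t is Named _ then true else false.
pose arg t := match t with Named c | At c => c end.
move=> acA acB.
have := ac0_if (fun i => named (tk i))
  (ac0_reindex (fun i => (i, arg (tk i))) acA)
  (ac0_reindex (fun i => (i, arg (tk i))) acB).
by apply: ac0_ext => i x; case: (tk i).
Qed.

End TokenFamilies.

Lemma ac0_bsegment I (tk : I -> token) (f g : I -> nat) :
  ac0 (fun i x => bsegment x (tk i) (f i) (g i)).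
Proof.
(* [A] and [B] rephrase the two cases of [bsegment] so that the part quantified over offsets has the
   shape of [ac0_forall_lt]. *)
pose A (i : I) (c : nat) x := g i = size (word c) /\
  (size (word c) <= size x /\ occurs x (f i) (word c)).
pose B (i : I) j x :=
  (g i <= size x /\ (forall r, r < g i -> ~~ (letter_at x (f i + r)).1 /\
                letter_at x (f i + r) = letter_at x (j + r))) /\
  (letter_at x (j + g i)).1.
have acA : ac0 (fun ij : I * nat => A ij.1 ij.2).
  apply: ac0_and.
    apply: ac0_ext (ac0_size (fun ij (_ : nat) => g ij.1 == size (word ij.2))).
    by move=> ij x; split=> /eqP.
  apply: (ac0_forall_lt (I := (I * nat)%type)).
  apply: ac0_ext (ac0_letter (fun p : I * nat * nat => f p.1.1 + p.2)
    (fun p s => s == nth (false, false) (word p.1.2) p.2)).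
  by move=> p x; split=> /eqP.
have acB : ac0 (fun ij : I * nat => B ij.1 ij.2).
  apply: ac0_and; last exact: (ac0_letter _ (fun _ s => s.1)).
  apply: (ac0_forall_lt (I := (I * nat)%type)); apply: ac0_and.
    exact: (ac0_letter (fun p : I * nat * nat => f p.1.1 + p.2)
             (fun _ s => ~~ s.1)).
  exact: ac0_same_letter.
apply: ac0_ext (ac0_token_case tk acA acB) => i x.
rewrite /bsegment; case: (tk i) => [c|j]; rewrite /A /B /=; last first.
  by split; [move=> [[? ?] ?]|move=> [? [? ?]]].
by split=> [[-> [? ?]]|[le_g [eg ?]]]; do !split=> //; rewrite -eg.
Qed.

Lemma ac0_token_eq_at I (tk : I -> token) (f : I -> nat) :
  ac0 (fun i x => token_eq_at x (f i) (tk i)).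
Proof.
apply: ac0_exists_lt; apply: ac0_and; first exact: ac0_bsegment.
exact: (ac0_letter _ (fun _ s => s.1)).
Qed.

Lemma ac0_token_eq I (tk uk : I -> token) :
  ac0 (fun i x => token_eq x (tk i) (uk i)).
Proof.
have acNN : ac0 (fun p : I * nat * nat => fun x : seq bool => p.1.2 = p.2).
  apply: ac0_ext (ac0_size (fun p (_ : nat) => p.1.2 == p.2)).
  by move=> p x; split=> /eqP.
have acNA := ac0_token_eq_at (fun p : I * nat * nat => Named p.1.2) snd.
have acA := ac0_token_eq_at (fun p : I * nat => uk p.1) snd.
have acN := @ac0_token_case _ (fun p : I * nat => uk p.1)
  (fun p c _ => p.2 = c) (fun p j x => token_eq_at x j (Named p.2)) acNN acNA.
apply: ac0_ext (@ac0_token_case _ tk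
  (fun i c x => match uk i with Named c' => c = c'
                | At j => token_eq_at x j (Named c) end)
  (fun i j x => token_eq_at x j (uk i)) acN acA) => i x.
by case: (tk i).
Qed.

(** The list [ts] is common to all indices, so the depth is constant. Each guessed length joins the
    index, hence the induction generalises the index type. *)
Lemma ac0_args_at I (f : I -> nat) (T : Type) (ts : seq T) (tk : I -> T -> token) :
  ac0 (fun i x => args_at x (f i) (map (tk i) ts)).
Proof.
elim: ts I f tk => [|t ts IHts] I f tk /=.
  apply: ac0_ext (ac0_letter f (fun _ s => s == dollar)).
  by move=> i x; split=> /eqP.
apply: ac0_and.
  apply: ac0_ext (ac0_letter f (fun _ s => s == hash)).
  by move=> i x; split=> /eqP.
apply: ac0_exists_lt; apply: ac0_and; first exact: ac0_bsegment.
exact: IHts (I * nat)%type (fun p => (f p.1).+1 + p.2) (fun p => tk p.1).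
Qed.

(** * Parsing the encoding of a pair of databases *)

Lemma In_cat (T : Type) (a : T) s1 s2 :
  List.In a (s1 ++ s2) <-> List.In a s1 \/ List.In a s2.
Proof. by elim: s1 => [|b s1 IHs] /=; [tauto|rewrite IHs; tauto]. Qed.

Lemma In_splitP (T : Type) (a : T) s :
  List.In a s <-> exists s1 s2, s = s1 ++ a :: s2.
Proof.
split=> [|[s1 [s2 ->]]]; last by rewrite In_cat; right; left.
elim: s => //= b s IHs [->|/IHs[s1 [s2 ->]]]; first by exists [::], s.
by exists (b :: s1), s2.
Qed.

Lemma letter_at_spell_lt w i : (letter_at (spell w) i).1 -> i < size w.
Proof.
by rewrite letter_at_spell; case: ltnP => // le_w; rewrite nth_default.
Qed.

Definition start (x : seq bool) (i : nat) : Prop :=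
  i = 0 \/ letter_at x i.-1 = dollar.

Section Parsing.
Variable S : signature.
Implicit Types (D : database S) (f : fact S).

Definition word_fact f : seq letter :=
  word (enum_rank (fpred f)) ++ word_args (fargs f).

(* [None] stands for the separator between the two databases. *)
Definition piece (o : option (fact S)) : seq letter :=
  if o is Some f then word_fact f else [:: dollar].

Definition pieces (L : seq (option (fact S))) : seq letter :=
  flatten (map piece L).

Definition items D D' := map Some D ++ None :: map Some D'.
Definition text D D' : seq letter := pieces (items D D').

Lemma pieces_cat L1 L2 : pieces (L1 ++ L2) = pieces L1 ++ pieces L2.
Proof. by rewrite /pieces map_cat flatten_cat. Qed.

Lemma spell_cat w1 w2 : spell (w1 ++ w2) = spell w1 ++ spell w2.
Proof. by rewrite /spell map_cat flatten_cat. Qed.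

Lemma spell_flatten ws : spell (flatten ws) = flatten (map spell ws).
Proof. by elim: ws => //= w ws IHws; rewrite spell_cat IHws. Qed.

Lemma spell_word n : spell (word n) = enc_nat n.
Proof.
rewrite /enc_nat /word /spell; elim: (bin n) => //= b s ->.
by case: b.
Qed.

Lemma enc_fact_spell f : enc_fact f = spell (word_fact f).
Proof.
rewrite /enc_fact /word_fact spell_cat spell_word; congr (_ ++ _).
rewrite /word_args spell_cat spell_flatten -map_comp; congr (flatten _ ++ _).
by apply: eq_map => c; rewrite -spell_word.
Qed.

Lemma enc_db_spell D : enc_db D = spell (pieces (map Some D)).
Proof.
rewrite /enc_db /pieces spell_flatten -!map_comp; congr flatten.
by apply: eq_map => f; apply: enc_fact_spell.
Qed.

Lemma enc_pair_spell D D' : enc_pair (D, D') = spell (text D D').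
Proof.
rewrite /enc_pair /text /items pieces_cat spell_cat !enc_db_spell /=.
by congr (_ ++ _).
Qed.

Lemma dollar_notin_word n : dollar \notin word n.
Proof. by apply/mapP => -[b _]. Qed.

Lemma piece_rcons o : exists2 b, piece o = rcons b dollar & dollar \notin b.
Proof.
case: o => [f|] /=; last by exists [::].
exists (word (enum_rank (fpred f)) ++
  flatten [seq hash :: word c | c <- fargs f]).
  by rewrite /word_fact /word_args -cats1 catA.
rewrite mem_cat negb_or dollar_notin_word /=.
by elim: (fargs f) => //= c cs IHcs; rewrite inE mem_cat (negPf (dollar_notin_word c)).
Qed.

Lemma size_piece_gt0 o : 0 < size (piece o).
Proof. by have [b -> _] := piece_rcons o; rewrite size_rcons. Qed.

(** Every piece has its only [dollar] at the end, so a position following a [dollar] is a boundary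
    between pieces; the bound on [i] excludes the end of the last piece. *)
Lemma start_split L i : i < size (pieces L) -> start (spell (pieces L)) i ->
  exists L1 o L2, L = L1 ++ o :: L2 /\ i = size (pieces L1).
Proof.
rewrite /start letter_at_spell.
elim: L i => [|o L IHL] i //=; rewrite {1}/pieces /= -/(pieces L) size_cat => lt_i.
case: (posnP i) => [-> _|i_gt0 [/eqP|]]; [by exists [::], o, L|by lia|].
rewrite /pieces /= -/(pieces L) nth_cat.
have [b eb nb] := piece_rcons o; rewrite eb size_rcons in lt_i *.
case: ltnP => [lt_ib|le_bi] Ei.
  rewrite nth_rcons in Ei; case: (ltnP i.-1 (size b)) Ei => [lt_b Ei|le_b _].
    by move: nb; rewrite -Ei mem_nth.
  exists [:: o]; case: L IHL lt_i => [|o' L] IHL lt_i; first by move: lt_i; rewrite /pieces /=; lia.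
  exists o', L; split=> //; rewrite /pieces /= cats0 eb size_rcons; lia.
have [||L1 [o' [L2 [-> e_i]]]] := IHL (i - (size b).+1); first by lia.
  by right; rewrite -Ei; congr nth; lia.
exists (o :: L1), o', L2; split=> //.
by rewrite /pieces /= size_cat -/(pieces L1) -e_i eb size_rcons; lia.
Qed.

Lemma start_pieces L1 L2 :
  start (spell (pieces (L1 ++ L2))) (size (pieces L1)).
Proof.
case/lastP: L1 => [|L1 o]; first by left.
have [b eb _] := piece_rcons o.
have eL : pieces (rcons L1 o) = rcons (pieces L1 ++ b) dollar.
  by rewrite -cats1 pieces_cat /pieces /= cats0 eb rcons_cat.
right; rewrite letter_at_spell pieces_cat eL size_rcons nth_cat size_rcons leqnn.
by rewrite nth_rcons ltnn eqxx.
Qed.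

Definition separator x k : Prop := start x k /\ letter_at x k = dollar.

Lemma occurs_fact_head x i f : occurs x i (word_fact f) ->
  ~~ (letter_at x i).1.
Proof.
move=> /occurs_cat[/(_ 0)]; rewrite addn0 size_word size_bin_gt0 => /(_ isT) -> _.
by rewrite word_bit ?size_word ?size_bin_gt0.
Qed.

Lemma occurs_fact_inj x i f f' :
  occurs x i (word_fact f) -> occurs x i (word_fact f') -> f = f'.
Proof.
case: f f' => [p cs] [p' cs'] /occurs_cat[op ocs] /occurs_cat[op' ocs'] /=.
have eq_r : enum_rank p = enum_rank p' :> nat.
  by apply: (@denotes_At_inj x i); split=> //; apply: occurs_args_head; eassumption.
move: ocs'; rewrite /= -eq_r => /(occurs_args_inj ocs) <-.
by congr Fact; apply: enum_rank_inj; apply: val_inj.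
Qed.

Lemma occurs_piece L1 o L2 :
  occurs (spell (pieces (L1 ++ o :: L2))) (size (pieces L1)) (piece o).
Proof. by rewrite pieces_cat; apply: occurs_spell. Qed.

Lemma items_split D R L1 o L2 : map Some D ++ None :: R = L1 ++ o :: L2 ->
  [\/ exists f D1 D2, [/\ o = Some f, D = D1 ++ f :: D2 & L1 = map Some D1],
      o = None /\ L1 = map Some D |
      exists L1', L1 = map Some D ++ None :: L1' /\ R = L1' ++ o :: L2].
Proof.
elim: D L1 => [|f D IHD] [|o' L1] /= [].
- by move=> <- _; apply: Or32.
- by move=> <- ->; apply: Or33; exists L1.
- by move=> <- _; apply: Or31; exists f, [::], D.
move=> <- /IHD[[g [D1 [D2 [-> -> ->]]]]|[-> ->]|[L1' [-> ->]]].
- by apply: Or31; exists g, (f :: D1), D2.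
- exact: Or32.
- by apply: Or33; exists L1'.
Qed.

Lemma map_Some_split D L1 f L2 :
  map Some D = L1 ++ Some f :: L2 -> List.In f D.
Proof.
elim: D L1 => [|g D IHD] [|o L1] //= []; first by move=> -> _; left.
by move=> _ /IHD; right.
Qed.

Lemma map_Some_neq_None D L1 L2 : map Some D <> L1 ++ None :: L2.
Proof. by elim: D L1 => [|g D IHD] [|o L1] //= [_ /IHD]. Qed.

(** A fact starts with a digit, so a [dollar] at the start of a piece can only be the separator. *)
Lemma separatorP D D' k :
  separator (spell (text D D')) k <-> k = size (pieces (map Some D)).
Proof.
split=> [[st_k ek]|->]; last first.
  split; first exact: start_pieces.
  by have /occurs1 := @occurs_piece (map Some D) None (map Some D').
have [|L1 [o [L2 [eL eq_k]]]] := start_split _ st_k.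
  by apply: letter_at_spell_lt; rewrite ek.
have oo : occurs (spell (text D D')) k (piece o).
  by rewrite /text eL eq_k; apply: occurs_piece.
case: o eL oo => [f|] eL; first by move/occurs_fact_head; rewrite ek.
case: (items_split eL) eq_k => [[f [? [? []]]] //|[_ ->] //|[L1' [_ eR]]].
by case: (map_Some_neq_None eR).
Qed.

(** Without [start], the tail of a longer fact, such as an argument followed by the remaining ones,
    would read as a fact of its own. *)
Definition fact_at x i (p : sym S) ts : Prop :=
  start x i /\
  exists l, l < size x /\
    (bsegment x (Named (enum_rank p)) i l /\ args_at x (i + l) ts).

Lemma fact_atP x i p ts cs : denote_all x ts cs ->
  fact_at x i p ts <-> start x i /\ occurs x i (word_fact (Fact p cs)).
Proof.
move=> dts; rewrite /fact_at /word_fact occurs_cat /=.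
split=> -[st_i H]; split=> //.
  by case: H => l [_ [[_ [-> op]] /(args_atP _ dts)]].
case: H => op ocs; exists (size (word (enum_rank p))).
have lt_x : size (word (enum_rank p)) < size x.
  apply: leq_ltn_trans (letter_at_lt (occurs_args_head ocs)); exact: leq_addl.
by do !split=> //; [apply: ltnW|apply/(args_atP _ dts)].
Qed.

Definition fact_in (left : bool) (p : sym S) ts x : Prop :=
  exists i, i < size x /\ (fact_at x i p ts /\
    exists k, k < size x /\
      (separator x k /\ (if left then i < k else k < i))).

Lemma word_fact_lt w i f : occurs (spell w) i (word_fact f) -> i < size w.
Proof.
move=> /occurs_cat[_ /occurs_args_head /letter_at_spell_lt].
by apply: leq_ltn_trans; apply: leq_addr.
Qed.

Lemma size_pieces_lt L1 o L2 : size (pieces L1) < size (pieces (L1 ++ o :: L2)).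
Proof.
rewrite pieces_cat size_cat {3}/pieces /= size_cat.
have := size_piece_gt0 o; lia.
Qed.

(** A start inside the text begins a piece, unique readability identifies this piece with the fact,
    and the side of the separator on which it lies tells the database. *)
Lemma fact_inP D D' b p ts cs : denote_all (spell (text D D')) ts cs ->
  fact_in b p ts (spell (text D D')) <->
  List.In (Fact p cs) (if b then D else D').
Proof.
set x := spell _ => dts; split.
  move=> [i [_ [/(fact_atP _ _ dts)[st_i of_i] [k [_ [/separatorP -> lt_ik]]]]]].
  have [L1 [o [L2 [eL eq_i]]]] := start_split (word_fact_lt of_i) st_i.
  have oo : occurs x i (piece o).
    by rewrite /x /text eL eq_i; apply: occurs_piece.
  case: o eL oo => [f|] eL oo; last first.
    by move/occurs1: oo => ei; move: (occurs_fact_head of_i); rewrite ei.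
  rewrite (occurs_fact_inj of_i oo).
  case: (items_split eL) => [[g [D1 [D2 [[<-] eD eL1]]]]|[//]|[L1' [eL1 eR]]].
    have lt_i : i < size (pieces (map Some D)).
      by rewrite eq_i eL1 eD map_cat size_pieces_lt.
    by case: b lt_ik => [_|]; [apply/In_splitP; exists D1, D2|lia].
  have lt_i : size (pieces (map Some D)) < i by rewrite eq_i eL1 size_pieces_lt.
  by case: b lt_ik => [|_]; [lia|apply: map_Some_split eR].
pose m := size (pieces (map Some D)).
have sep_m : separator x m by apply/separatorP.
have lt_m : m < size x by apply: letter_at_lt; have [_ ->] := sep_m.
have witness L1 L2 : items D D' = L1 ++ Some (Fact p cs) :: L2 ->
    fact_at x (size (pieces L1)) p ts /\ size (pieces L1) < size x.
  move=> eL; have oi : occurs x (size (pieces L1)) (word_fact (Fact p cs)).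
    by rewrite /x /text eL; exact: (@occurs_piece L1 (Some _) L2).
  split; first by apply/(fact_atP _ _ dts); split=> //; rewrite /x /text eL; apply: start_pieces.
  apply: leq_ltn_trans (letter_at_lt (occurs_args_head (proj2 (proj1 (occurs_cat _ _ _ _) oi)))).
  exact: leq_addr.
case: b => /In_splitP[D1 [D2 eD]].
  have [|fa lt_x] := witness (map Some D1) (map Some D2 ++ None :: map Some D').
    by rewrite /items eD map_cat -catA.
  exists (size (pieces (map Some D1))); do 2!split=> //; exists m; do 2!split=> //.
  by rewrite /m eD map_cat size_pieces_lt.
have [|fa lt_x] := witness (map Some D ++ None :: map Some D1) (map Some D2).
  by rewrite /items eD map_cat -catA.
exists (size (pieces (map Some D ++ None :: map Some D1))).
by do 2!split=> //; exists m; do 2!split=> //; apply: size_pieces_lt.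
Qed.

(** * The active domain read off the encoding *)

Definition word_after_hash (A : nat -> Prop) (w : seq letter) : Prop :=
  forall j, nth (false, false) w j = hash ->
    exists c y w', [/\ A c, drop j.+1 w = word c ++ y :: w' & y.1].

(** The number behind a [hash] and its marker [y] both lie inside the word, so appending or
    prepending letters does not disturb them. *)
Lemma word_after_hash_cat A w1 w2 : word_after_hash A w1 ->
  word_after_hash A w2 -> word_after_hash A (w1 ++ w2).
Proof.
move=> ok1 ok2 j; rewrite nth_cat; case: ltnP => [lt_j /ok1|le_j /ok2].
  move=> [c [y [w' [Ac ew ey]]]]; exists c, y, (w' ++ w2); split=> //.
  rewrite drop_cat; case: ltnP => [_|le_j]; first by rewrite ew -catA.
  by move: ew; rewrite drop_oversize //; case: (word c).
move=> [c [y [w' [Ac ew ey]]]]; exists c, y, w'; split=> //.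
by rewrite drop_cat ltnNge (leqW le_j) /= subSn.
Qed.

Lemma word_after_hash_word A n : word_after_hash A (word n).
Proof.
move=> j ej; case: (ltnP j (size (word n))) => [lt_j|le_j].
  by have := word_bit lt_j; rewrite ej.
by rewrite nth_default in ej.
Qed.

Lemma word_after_hash_args (A : nat -> Prop) cs : (forall c, c \in cs -> A c) ->
  word_after_hash A (word_args cs).
Proof.
elim: cs => [|c cs IHcs] Acs; first by case=> [|[|j]].
rewrite word_args_cons => -[_|j].
  have [y [w' [-> ey]]] : exists y w', word_args cs = y :: w' /\ y.1.
    case: (cs) => [|c' cs']; first by exists dollar, [::].
    by rewrite word_args_cons /=; exists hash, (word c' ++ word_args cs').
  by exists c, y, w'; rewrite /= drop0; split=> //; apply: Acs; rewrite mem_head.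
apply: (word_after_hash_cat (@word_after_hash_word A c)).
by apply: IHcs => d dcs; apply: Acs; rewrite inE dcs orbT.
Qed.

Lemma word_after_hash_pieces (A : nat -> Prop) L :
  (forall f c, List.In (Some f) L -> c \in fargs f -> A c) ->
  word_after_hash A (pieces L).
Proof.
elim: L => [|o L IHL] AL; first by move=> j; rewrite nth_nil.
apply: word_after_hash_cat; last first.
  by apply: IHL => f c fL; apply: AL; right.
case: o AL => [f|] AL /=; last exact: word_after_hash_args [::] _.
apply: word_after_hash_cat; first exact: word_after_hash_word.
by apply: word_after_hash_args => c; apply: AL; left.
Qed.

Definition adom D D' (c : nat) : Prop :=
  exists2 f, List.In f D \/ List.In f D' & c \in fargs f.

Lemma In_items D D' f :
  List.In (Some f) (items D D') <-> List.In f D \/ List.In f D'.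
Proof.
have map_In E : List.In (Some f) (map Some E) <-> List.In f E.
  elim: E => //= g E IHE; rewrite IHE.
  by split=> -[e|]; [left; case: e|right|left; rewrite e|right].
by rewrite /items In_cat /= !map_In; intuition.
Qed.

(** Together with [hash_covers]: the numbers behind hashes are exactly the active domain, since
    predicate codes are never preceded by a [hash]. *)
Lemma hash_denotes D D' j : letter_at (spell (text D D')) j = hash ->
  exists2 c, adom D D' c & denotes (spell (text D D')) (At j.+1) c.
Proof.
move=> ej; have lt_j : j < size (text D D').
  by apply: letter_at_spell_lt; rewrite ej.
have ok : word_after_hash (adom D D') (text D D').
  by apply: word_after_hash_pieces => f c /In_items fD cf; exists f.
move: ej; rewrite letter_at_spell => /ok[c [y [w' [ac ew ey]]]].
exists c => //; have sz_j : size (take j.+1 (text D D')) = j.+1 by apply: size_takel.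
have := @occurs_spell (take j.+1 (text D D')) (word c ++ [:: y]) w'.
rewrite -catA /= -ew cat_take_drop sz_j => /occurs_cat[oc /occurs1 e_y].
by split=> //; have := f_equal fst e_y; rewrite ey.
Qed.

Lemma hash_covers D D' c : adom D D' c ->
  exists2 j, letter_at (spell (text D D')) j = hash &
             denotes (spell (text D D')) (At j.+1) c.
Proof.
move=> [f fD cf]; have [L1 [L2 eL]] : exists L1 L2, items D D' = L1 ++ Some f :: L2.
  by apply/In_splitP/In_items.
have [cs1 [cs2 ecs]] : exists cs1 cs2, fargs f = cs1 ++ c :: cs2.
  by case/splitPr: cf => cs1 cs2; exists cs1, cs2.
pose w1 := pieces L1 ++ word (enum_rank (fpred f)) ++
  flatten [seq hash :: word d | d <- cs1].
have -> : text D D' = w1 ++ word_args (c :: cs2) ++ pieces L2.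
  rewrite /text eL pieces_cat /w1 -!catA; congr (_ ++ _).
  rewrite {1}/pieces /= /word_fact ecs /word_args map_cat flatten_cat -!catA.
  by [].
have /occurs_args_cons[eh [oc ocs]] := @occurs_spell w1 (word_args (c :: cs2)) (pieces L2).
exists (size w1) => //; split=> //; exact: occurs_args_head ocs.
Qed.

Lemma ac0_fact_in I T b p (ts : seq T) (tk : I -> T -> token) :
  ac0 (fun i => fact_in b p (map (tk i) ts)).
Proof.
have ac_dollar J (f : J -> nat) : ac0 (fun i x => letter_at x (f i) = dollar).
  apply: ac0_ext (ac0_letter f (fun _ s => s == dollar)).
  by move=> i x; split=> /eqP.
have ac_start J (f : J -> nat) : ac0 (fun i x => start x (f i)).
  apply: ac0_or => //.
  apply: ac0_ext (ac0_size (fun i (_ : nat) => f i == 0)).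
  by move=> i x; split=> /eqP.
apply: ac0_exists_lt; apply: ac0_and.
  apply: ac0_and => //; apply: ac0_exists_lt; apply: ac0_and.
    exact: ac0_bsegment.
  exact: (ac0_args_at (fun p => p.1.2 + p.2) ts (fun p => tk p.1.1)).
apply: ac0_exists_lt; apply: ac0_and; first by apply: ac0_and.
have := ac0_size (fun (p : I * nat * nat) (_ : nat) => if b then p.1.2 < p.2 else p.2 < p.1.2).
by apply: ac0_ext => ij x; case: b.
Qed.

End Parsing.

(** * First-order properties of pairs of databases *)

Definition term_consts (t : term) : seq nat := if t is TConst c then [:: c] else [::].

Definition term_val (u : nat -> nat) (t : term) : nat :=
  match t with TConst c => c | TVar y => u y end.

Definition term_token (v : nat -> token) (t : term) : token :=
  match t with TConst c => Named c | TVar y => v y end.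

Definition upd (T : Type) (u : nat -> T) (y : nat) (e : T) : nat -> T :=
  fun z => if z == y then e else u z.

Section PairFormulas.
Variable S : signature.
Implicit Types (D : database S).

(* [PAtom b p ts] refers to the first database if [b], else to the second. *)
Inductive pfo :=
  | PAtom of bool & sym S & seq term
  | PEq of term & term
  | PNot of pfo
  | PAnd of pfo & pfo
  | PEx of nat & pfo.

Fixpoint pholds D D' (u : nat -> nat) (phi : pfo) : Prop :=
  match phi with
  | PAtom b p ts => List.In (Fact p (map (term_val u) ts)) (if b then D else D')
  | PEq t t' => term_val u t = term_val u t'
  | PNot a => ~ pholds D D' u a
  | PAnd a b => pholds D D' u a /\ pholds D D' u b
  | PEx y a => exists e, pholds D D' (upd u y e) a
  end.

Fixpoint pconsts (phi : pfo) : seq nat :=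
  match phi with
  | PAtom _ _ ts => flatten (map term_consts ts)
  | PEq t t' => term_consts t ++ term_consts t'
  | PNot a => pconsts a
  | PAnd a b => pconsts a ++ pconsts b
  | PEx _ a => pconsts a
  end.

(** * Swapping elements outside the active domain *)

Definition swap (a b c : nat) : nat := if c == a then b else if c == b then a else c.

Lemma swapK a b : involutive (swap a b).
Proof. by move=> c; rewrite /swap; do !case: eqP => //; congruence. Qed.

Lemma swap_id a b c : c <> a -> c <> b -> swap a b c = c.
Proof. by rewrite /swap; do !case: eqP. Qed.

Lemma upd_swap a b u y e :
  swap a b \o upd u y e = upd (swap a b \o u) y (swap a b e).
Proof. by apply: functional_extensionality => z; rewrite /upd /=; case: eqP. Qed.

Section Swap.
Variables (D D' : database S) (a b : nat).
Hypothesis (a_adom : ~ adom D D' a) (b_adom : ~ adom D D' b).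

Lemma In_swap E p cs : (E = D \/ E = D') ->
  List.In (Fact p cs) E -> List.In (Fact p (map (swap a b) cs)) E.
Proof.
move=> eE fE; have adom_cs c : c \in cs -> adom D D' c.
  by move=> ccs; exists (Fact p cs) => //; case: eE => <-; [left|right].
suff -> : map (swap a b) cs = cs by [].
rewrite -[RHS]map_id; apply/eq_in_map => c /adom_cs ac.
by apply: swap_id => e; rewrite e in ac.
Qed.

(** The swap fixes every fact and every constant of [phi], so it acts as an automorphism of the pair
    of databases and carries witnesses of quantifiers to witnesses. *)
Lemma pholds_swap phi u : a \notin pconsts phi -> b \notin pconsts phi ->
  pholds D D' u phi <-> pholds D D' (swap a b \o u) phi.
Proof.
have swap_term t w : a \notin term_consts t -> b \notin term_consts t ->
    term_val (swap a b \o w) t = swap a b (term_val w t).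
  by case: t => //= c; rewrite !inE => /eqP na /eqP nb; rewrite swap_id => // e; congruence.
elim: phi u => [s p ts|t t'|phi IH|phi IH psi IH'|y phi IH] u /=.
- move=> na nb.
  have -> : map (term_val (swap a b \o u)) ts = map (swap a b) (map (term_val u) ts).
    rewrite -map_comp; elim: ts na nb => //= t ts IHts.
    rewrite !mem_cat !negb_or => /andP[na nas] /andP[nb nbs].
    by rewrite swap_term // IHts.
  have eE : (if s then D else D') = D \/ (if s then D else D') = D'.
    by case: s; [left|right].
  split; first exact: In_swap.
  by move=> /(In_swap eE); rewrite (mapK (swapK a b)).
- rewrite !mem_cat !negb_or => /andP[na na'] /andP[nb nb'].
  by rewrite !swap_term //; split=> [->|/(inv_inj (swapK a b))].
- by move=> na nb; rewrite (IH u).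
- rewrite !mem_cat !negb_or => /andP[na na'] /andP[nb nb'].
  by rewrite (IH u) // (IH' u).
move=> na nb; split=> -[e He].
  by exists (swap a b e); rewrite -upd_swap -IH.
exists (swap a b e); rewrite IH // upd_swap swapK //.
Qed.

End Swap.

(* Larger than all constants of [C] and all numbers in an input of [n] bits. *)
Definition base (C : seq nat) (n : nat) : nat := 2 ^ n + sumn C.

(* A quantifier in the scope of [k] others ranges over the numbers of the input,
   the constants and [k + 1] fresh elements: elements outside the active domain
   can be swapped. *)
Fixpoint tholds (C : seq nat) (k : nat) (phi : pfo) (v : nat -> token)
    (x : seq bool) : Prop :=
  match phi with
  | PAtom b p ts => fact_in b p (map (term_token v) ts) x
  | PEq t t' => token_eq x (term_token v t) (term_token v t')
  | PNot a => ~ tholds C k a v x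
  | PAnd a b => tholds C k a v x /\ tholds C k b v x
  | PEx y a =>
      (exists j, j < size x /\
         (letter_at x j = hash /\ tholds C k.+1 a (upd v y (At j.+1)) x)) \/
      (exists2 c, c \in C ++ iota (base C (size x)) k.+1 &
         tholds C k.+1 a (upd v y (Named c)) x)
  end.

Lemma ac0_tholds C k phi : ac0 (fun v => tholds C k phi v).
Proof.
elim: phi k => [s p ts|t t'|phi IH|phi IH psi IH'|y phi IH] k /=.
- exact: ac0_fact_in.
- exact: ac0_token_eq.
- exact: ac0_not.
- exact: ac0_and.
apply: ac0_or.
  apply: ac0_exists_lt; apply: ac0_and.
    apply: ac0_ext (ac0_letter (fun vj : (nat -> token) * nat => vj.2)
      (fun _ s => s == hash)) => vj x; by split=> /eqP.
  exact: (ac0_reindex (fun vj : (nat -> token) * nat => upd vj.1 y (At vj.2.+1))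
           (IH k.+1)).
(* The list has constant length [m = size C + k.+1], and [m < (n + 2) ^ m] provides the exponent. *)
apply: (@ac0_exists _ (size C + k.+1)
  (fun _ n => C ++ iota (base C n) k.+1)
  (fun v c => tholds C k.+1 phi (upd v y (Named c)))).
  move=> _ n; rewrite size_cat size_iota; apply: ltnW.
  by apply: ltn_expl; rewrite addn2.
exact: (ac0_reindex (fun vc : (nat -> token) * nat => upd vc.1 y (Named vc.2))
         (IH k.+1)).
Qed.

Definition level C D D' k (c : nat) : Prop :=
  adom D D' c \/ c \in C ++ iota (base C (size (spell (text D D')))) k.

(** The digits of an element of the active domain lie within the input, so they are fewer than its
    bits; the numbers from [base] on are therefore fresh. *)
Lemma adom_lt C D D' c : adom D D' c -> c < base C (size (spell (text D D'))).
Proof.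
move=> /hash_covers[j _ dj].
apply: leq_trans (ltn_bin c) _; apply: leq_trans (leq_addr _ _).
by rewrite leq_exp2l // -size_word ltnW // (size_word_lt dj).
Qed.

Lemma const_lt C n c : c \in C -> c < base C n.
Proof.
move=> cC; apply: (@leq_ltn_trans (sumn C)).
  by elim: C cC => //= a C IH; rewrite inE => /orP[/eqP ->|/IH]; lia.
by rewrite -[X in X < _]add0n ltn_add2r expn_gt0.
Qed.

(** A witness outside level [k] is exchanged with the fresh element at offset [k] from [base]. The
    swap moves no value of [u], all of which are of level [k], so one new fresh element per
    quantifier suffices. *)
Lemma pholds_exists C D D' k phi u y :
  {subset pconsts phi <= C} ->
  (forall z, level C D D' k (u z)) ->
  (exists e, pholds D D' (upd u y e) phi) ->
  exists2 e, level C D D' k.+1 e & pholds D D' (upd u y e) phi.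
Proof.
move=> sub_C lev_u [e He].
have iotaS n m : n + m \in iota n m.+1 by rewrite mem_iota; lia.
set n := base C (size (spell (text D D'))).
case: (classic (level C D D' k e)) => lev_e.
  exists e => //; case: lev_e => [?|]; [by left|right].
  move: b; rewrite !mem_cat !mem_iota; lia.
have new_b : ~ level C D D' k (n + k).
  case=> [/(@adom_lt C)|]; rewrite -/n; first by lia.
  by rewrite mem_cat => /orP[/(@const_lt _ (size (spell (text D D'))))|];
    rewrite -/n ?mem_iota; lia.
exists (n + k); first by right; rewrite mem_cat iotaS orbT.
have eq_u : swap e (n + k) \o u = u.
  apply: functional_extensionality => z /=; apply: swap_id => ez.
    by case: lev_e; rewrite -ez.
  by case: new_b; rewrite -ez.
have new_C c : ~ level C D D' k c -> c \notin pconsts phi.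
  by move=> nl; apply/negP=> /sub_C cC; case: nl; right; rewrite mem_cat cC.
have na : ~ adom D D' e by move=> ae; case: lev_e; left.
have nb : ~ adom D D' (n + k) by move=> ab; case: new_b; left.
move: He => /(pholds_swap na nb _ (new_C _ lev_e) (new_C _ new_b)).
by rewrite upd_swap eq_u /swap eqxx.
Qed.

(** Positions behind a [hash] stand for the active domain and named tokens for themselves;
    [pholds_exists] brings any other witness into this range. *)
Lemma tholdsP C D D' k phi u v :
  {subset pconsts phi <= C} ->
  (forall z, level C D D' k (u z)) ->
  (forall z, denotes (spell (text D D')) (v z) (u z)) ->
  tholds C k phi v (spell (text D D')) <-> pholds D D' u phi.
Proof.
set x := spell (text D D').
have den_term w h t : (forall z, denotes x (w z) (h z)) ->
    denotes x (term_token w t) (term_val h t).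
  by move=> den; case: t => //= y; apply: den.
elim: phi k u v => [s p ts|t t'|phi IH|phi IH psi IH'|y phi IH] k u v /= sub_C lev_u den_u.
- apply: fact_inP; elim: ts {sub_C} => //= t ts IHts; split=> //.
  exact: den_term.
- by apply: token_eqP; apply: den_term.
- by rewrite (IH k u).
- by rewrite (IH k u) ?(IH' k u) // => c cc; apply: sub_C; rewrite mem_cat cc ?orbT.
have lev_upd e : level C D D' k.+1 e -> forall z, level C D D' k.+1 (upd u y e z).
  move=> lev_e z; rewrite /upd; case: eqP => // _.
  case: (lev_u z) => [?|]; [by left|right].
  move: b; rewrite !mem_cat !mem_iota; lia.
have den_upd t e : denotes x t e -> forall z, denotes x (upd v y t z) (upd u y e z).
  by move=> dt z; rewrite /upd; case: eqP.
split.
  case=> [[j [_ [ej Hj]]]|[c cC Hc]].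
    have [c ac dc] := hash_denotes ej.
    exists c; apply/(IH k.+1 _ (upd v y (At j.+1))) => //; last exact: den_upd.
    by apply: lev_upd; left.
  exists c; apply/(IH k.+1 _ (upd v y (Named c))) => //; last exact: den_upd.
  by apply: lev_upd; right.
move=> /(pholds_exists sub_C lev_u)[c lev_c Hc].
case: (lev_c) => [/hash_covers[j ej dc]|cC].
  left; exists j; split; first by apply: letter_at_lt; rewrite ej.
  split=> //; apply/(IH k.+1 (upd u y c)) => //; first exact: lev_upd.
  exact: den_upd.
right; exists c => //; apply/(IH k.+1 (upd u y c)) => //; first exact: lev_upd.
exact: den_upd.
Qed.

End PairFormulas.

Lemma poly_bound k : exists K, forall n, (n + 2) ^ k <= n ^ K + K.
Proof.
(* For [n <= 1] the constant [3 ^ k] suffices, and for [n >= 2] one has [n + 2 <= n ^ 2]. *)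
exists (2 * k + 3 ^ k) => -[|[|n]].
- apply: leq_trans (leq_addl _ _); apply: leq_trans (leq_addl _ _).
  by case: k => // k; rewrite leq_exp2r.
- by apply: leq_trans (leq_addl _ _); apply: leq_trans (leq_addl _ _).
apply: leq_trans (leq_addr _ _).
apply: (@leq_trans (n.+2 ^ (2 * k))); last by apply: leq_pexp2l; rewrite ?leq_addr.
rewrite expnM; case: k => // k; rewrite leq_exp2r //; lia.
Qed.

Section Definability.
Variable S : signature.
Implicit Types (D : database S).

Lemma pfo_in_AC0 (Valid P : database S * database S -> Prop) (phi : pfo S) :
  (forall D D' u, Valid (D, D') -> (pholds D D' u phi <-> P (D, D'))) ->
  in_AC0 Valid (@enc_pair S) P.
Proof.
(* With 0 among the constants, the valuation constant at 0, denoted by the token [Named 0], is of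
   level 0; the hypothesis on [phi] allows any valuation. *)
move=> phiP; pose C := 0 :: pconsts phi.
have [d [k [F FP]]] := ac0_tholds C 0 phi.
have [K KP] := poly_bound k; pose v (_ : nat) := Named 0.
exists d, K, (fun n => F n v); split=> [n|[D D'] DD_ok].
  by have [dF sF _] := FP n v; split=> //; apply: leq_trans sF (KP n).
rewrite -(phiP D D' (fun _ => 0)) //.
have [_ _ eF] := FP (size (enc_pair (D, D'))) v.
rewrite -[_ = true]/(is_true _) (eF _ erefl) enc_pair_spell.
apply: tholdsP => // [c cc|z]; first by rewrite inE cc orbT.
by right; rewrite mem_head.
Qed.

(** * Derived connectives and existential closure *)

Definition PAll (l : seq (pfo S)) : pfo S :=
  foldr (@PAnd S) (PEq S (TConst 0) (TConst 0)) l.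

Definition PExs (ys : seq nat) (phi : pfo S) : pfo S := foldr (@PEx S) phi ys.

Definition PTuple (left : bool) (p : sym S) (xs : seq nat) : pfo S :=
  PAtom left p (map TVar xs).

(** Bound variables are listed as well; quantifying over them once more in [PClose] is harmless. *)
Fixpoint pvars (phi : pfo S) : seq nat :=
  match phi with
  | PAtom _ _ ts => flatten (map term_vars ts)
  | PEq t t' => term_vars t ++ term_vars t'
  | PNot a => pvars a
  | PAnd a b => pvars a ++ pvars b
  | PEx y a => y :: pvars a
  end.

Definition PClose (phi : pfo S) : pfo S := PExs (pvars phi) phi.

Lemma pholds_all D D' u l :
  pholds D D' u (PAll l) <-> forall phi, List.In phi l -> pholds D D' u phi.
Proof.
elim: l => [|phi l IHl] //=; rewrite IHl.
split=> [[Hphi Hl] psi [<-|/Hl]|H] //.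
by split=> [|psi psil]; apply: H; [left|right].
Qed.

Lemma pholds_exs D D' u ys phi :
  pholds D D' u (PExs ys phi) <->
  exists2 w, (forall z, z \notin ys -> w z = u z) & pholds D D' w phi.
Proof.
elim: ys u => [|y ys IHys] u /=.
  split=> [Hu|[w /(_ _ isT) ew]]; first by exists u.
  by suff -> : w = u by []; apply: functional_extensionality.
split=> [[e /IHys[w ew Hw]]|[w ew Hw]].
  exists w => // z; rewrite inE negb_or => /andP[/negPf zy zys].
  by rewrite ew // /upd zy.
exists (w y); apply/IHys; exists w => // z zys; rewrite /upd.
by case: eqP => [-> //|/eqP zy]; rewrite ew // inE negb_or zy.
Qed.

Lemma pholds_agree D D' phi u w : {in pvars phi, u =1 w} ->
  pholds D D' u phi <-> pholds D D' w phi.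
Proof.
have val_agree t (a b : nat -> nat) : {in term_vars t, a =1 b} ->
    term_val a t = term_val b t.
  by case: t => //= y; apply; rewrite mem_head.
elim: phi u w => [s p ts|t t'|phi IH|phi IH psi IH'|y phi IH] u w /= uw.
- suff -> : map (term_val u) ts = map (term_val w) ts by [].
  elim: ts uw => //= t ts IHts uw; rewrite (val_agree t u w).
    by rewrite IHts // => z zts; apply: uw; rewrite mem_cat zts orbT.
  by move=> z zt; apply: uw; rewrite mem_cat zt.
- rewrite (val_agree t u w) ?(val_agree t' u w) // => z zt;
    by apply: uw; rewrite mem_cat zt ?orbT.
- by rewrite (IH u w).
- rewrite (IH u w) ?(IH' u w) // => z zt;
    by apply: uw; rewrite mem_cat zt ?orbT.
have upd_agree e : {in pvars phi, upd u y e =1 upd w y e}.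
  by move=> z zphi; rewrite /upd; case: eqP => // _; apply: uw; rewrite inE zphi orbT.
by split=> -[e He]; exists e; apply/(IH _ _ (upd_agree e)).
Qed.

Lemma pholds_close D D' u phi :
  pholds D D' u (PClose phi) <-> exists w, pholds D D' w phi.
Proof.
rewrite pholds_exs; split=> [[w _ Hw]|[w Hw]]; first by exists w.
exists (fun z => if z \in pvars phi then w z else u z).
  by move=> z /negPf ->.
by apply/(@pholds_agree _ _ _ _ w) => // z zphi /=; rewrite zphi.
Qed.

Lemma pholds_tuple D D' u b p xs :
  pholds D D' u (PTuple b p xs) <->
  List.In (Fact p (map u xs)) (if b then D else D').
Proof. by rewrite /= -map_comp. Qed.

Lemma In_map (T U : Type) (g : T -> U) s b :
  List.In b (map g s) <-> exists2 a, List.In a s & b = g a.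
Proof.
elim: s => [|a s IHs] /=; first by split=> // -[].
rewrite IHs; split=> [[<-|[a' ? ->]]|[a' [<-|?] ->]].
- by exists a; [left|].
- by exists a'; [right|].
- by left.
- by right; exists a'.
Qed.

Lemma In_mem (T : eqType) (a : T) s : List.In a s <-> a \in s.
Proof.
elim: s => //= b s IHs; rewrite inE IHs.
split=> [[->|->]|/orP[/eqP ->|]]; rewrite ?eqxx ?orbT //; [by left|by right].
Qed.

Lemma In_all (T : Type) (P : pred T) s : (forall a, List.In a s -> P a) -> all P s.
Proof.
by elim: s => //= b s IHs Ps; rewrite Ps ?IHs //; [move=> a sa; apply: Ps; right|left].
Qed.

Lemma all_In (T : Type) (P : pred T) s a : all P s -> List.In a s -> P a.
Proof. by elim: s => //= b s IHs /andP[Pb Ps] [<-|/IHs]; auto. Qed.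

(** * Repairs *)

Definition pred_vars (p : sym S) : seq nat := iota 0 (arity p).

Definition pred_query (p : sym S) : cq S :=
  CQ [::] [:: LAtom (Atom p (map TVar (pred_vars p)))].

Lemma wf_pred_query p : wf_cq (pred_query p).
Proof. by rewrite /wf_cq /wf_conj /= /wf_atom /= size_map size_iota eqxx. Qed.

(** For [p] equal to [bot] the first conjunct fails in every model, so the formula then says that no
    model exists. *)
Definition entailed (Sig : seq (dependency S)) E p cs : Prop :=
  forall M : structure S, is_model Sig E M ->
    p <> @bot S /\ rint p (map (cint M) cs).

Lemma certain_pred_query Sig E p h :
  certain Sig E (pred_query p) h <-> entailed Sig E p (map h (pred_vars p)).
Proof.
split=> cert M mM.
  have [v [ev /(_ _ (or_introl erefl))[pb /= rv]]] := cert M mM; split=> //.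
  suff -> : map (cint M) (map h (pred_vars p)) =
            map (teval v) (map TVar (pred_vars p)) by [].
  by rewrite -!map_comp; apply: eq_map => z /=; rewrite ev.
have [pb rp] := cert M mM; exists (fun x => cint M (h x)); split=> // l [<-|//].
split=> //=.
suff -> : map (teval (M := M) (fun x => cint M (h x))) (map TVar (pred_vars p)) =
          map (cint M) (map h (pred_vars p)) by [].
by rewrite -!map_comp; apply: eq_map.
Qed.

Lemma db_struct_model Sig D E :
  consistent Sig D -> db_subset E D -> is_model Sig E (db_struct D).
Proof.
move=> consD subE; split=> // -[p cs] /subE fD.
by rewrite /fact_holds /= map_id.
Qed.

Lemma In_filter (T : Type) (P : T -> Prop) s :
  exists s', forall a, List.In a s' <-> List.In a s /\ P a.
Proof.
elim: s => [|b s [s' IHs]]; first by exists [::] => a /=; tauto.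
case: (classic (P b)) => Pb; [exists (b :: s')|exists s'] => a /=; rewrite IHs.
  by split; [move=> [<-|]; tauto|tauto].
by split; [tauto|move=> [[<-|] ?]; tauto].
Qed.

Lemma teval_cint (M : structure S) D (v : nat -> nat) t :
  teval (M := M) (fun x => cint M (v x)) t = cint M (teval (M := db_struct D) v t).
Proof. by case: t. Qed.

Lemma map_teval_cint (M : structure S) D (v : nat -> nat) ts :
  map (teval (M := M) (fun x => cint M (v x))) ts =
  map (cint M) (map (teval (M := db_struct D) v) ts).
Proof. by rewrite -map_comp; apply: eq_map => t; apply: teval_cint. Qed.

Lemma conj_In (g : conj S) l : wf_conj g -> List.In l g ->
  if l is LAtom a then wf_atom a else true.
Proof. by move=> /andP[_ wfg]; apply: all_In wfg. Qed.

(* The entailed facts form the least model of [E] and [Sig], since [Sig] is full. *)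
Lemma entailed_consistent Sig E D'' :
  all (@wf_dep S) Sig -> all (@full S) Sig ->
  (exists M, is_model Sig E M) ->
  (forall p cs, size cs = arity p -> entailed Sig E p cs -> List.In (Fact p cs) D'') ->
  (forall p cs, List.In (Fact p cs) D'' -> entailed Sig E p cs) ->
  consistent Sig D''.
Proof.
move=> wfSig fullSig [M0 mM0] D''_in in_D'' d dSig v body_v.
have := all_In fullSig dSig; have := all_In wfSig dSig.
rewrite /wf_dep /full; case eq_h: (dhead d) => [|q [|//]] //.
move=> /and4P[_ _ _ /= /andP[/andP[wfq _] _]] /andP[/eqP ex_q _].
exists q; [by left|exists v; split=> //].
have head_M M : is_model Sig E M -> conj_holds (M := M) (fun x => cint M (v x)) (cq_body q).
  move=> mM; have [injM _ depM] := mM.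
  have [|q'] := depM d dSig (fun x => cint M (v x)).
    move=> [a|t u] /body_v /=.
      move=> [pb /in_D'' /(_ M mM)[_ ra]]; split=> //.
      by rewrite (map_teval_cint M D'').
    (* Inequalities of the body survive in [M] because distinct constants have distinct
       interpretations. *)
    by move=> ntu; rewrite !(teval_cint M D'') => /injM.
  rewrite eq_h => -[<-|//] [w [ew Hw]].
  (* Fullness leaves no quantified variable in the head, so the witnessing valuation is the given
     one and takes only constants as values. *)
  suff -> : (fun x => cint M (v x)) = w by [].
  by apply: functional_extensionality => z; rewrite ew // ex_q.
move=> l lq; have wfl := conj_In wfq lq.
case: l lq wfl => [a|t u] lq wfl /=; last first.
  (* The model [M0] supplies the inequalities of the head: equal constants would have equal
     interpretations in it. *)
  by have /= := head_M M0 mM0 _ lq; rewrite !(teval_cint M0 D'') => ntu e; rewrite e in ntu.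
split; first by have [] := head_M M0 mM0 _ lq.
apply: D''_in; first by rewrite size_map; apply/eqP.
move=> M mM; have [pb ra] := head_M M mM _ lq; split=> //.
by move: ra; rewrite (map_teval_cint M D'').
Qed.

Lemma repairP Sig D D' :
  all (@wf_dep S) Sig -> all (@full S) Sig -> wf_db D -> wf_db D' ->
  is_repair Sig D D' <->
  [/\ db_subset D' D, consistent Sig D' &
      forall f, List.In f D -> ~ List.In f D' ->
        exists p h, certain Sig (f :: D') (pred_query p) h /\
                    ~ List.In (Fact p (map h (pred_vars p))) D].
Proof.
move=> wfSig fullSig wfD wfD'; split=> -[subD consD' maxD']; split=> //.
  move=> f fD nfD'; apply: NNPP => no_g.
  (* Under the assumption [no_g], every entailed fact of correct length is in [D]; the valuation
     [nth 0 cs] maps the variables of the atomic query to the entries of [cs]. *)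
  have ent_D p cs : size cs = arity p -> entailed Sig (f :: D') p cs ->
      List.In (Fact p cs) D.
    move=> sz_cs ent; apply: NNPP => ncs; apply: no_g; exists p, (nth 0 cs).
    have -> : map (nth 0 cs) (pred_vars p) = cs.
      by rewrite /pred_vars -sz_cs -/(mkseq _ _) mkseq_nth.
    split=> //; apply/certain_pred_query.
    by rewrite /pred_vars -sz_cs -/(mkseq _ _) mkseq_nth.
  (* Without a model, [bot] would be entailed vacuously and hence lie in [D], which [wf_db]
     forbids. *)
  have model : exists M, is_model Sig (f :: D') M.
    apply: NNPP => no_M.
    have /(all_In wfD) : List.In (Fact (bot S) [::]) D.
      apply: ent_D => [|M mM]; first by rewrite arity_bot.
      by case: no_M; exists M.
    by rewrite /wf_fact eqxx andbF.
  (* The least model of [f :: D'], cut down to [D]; by [ent_D] the cut loses no fact of correct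
     length, so the result is a consistent extension of [D'] by [f]. *)
  have [D'' D''P] := In_filter (fun g => entailed Sig (f :: D') (fpred g) (fargs g)) D.
  have ent_f g : List.In g (f :: D') -> List.In g D''.
    move=> gf; have gD : List.In g D by case: gf => [<-|/subD].
    apply/D''P; split=> // M [_ /(_ _ gf) ? _]; split=> //.
    by apply/eqP; have /andP[] := all_In wfD gD.
  apply: nfD'; apply: (maxD' D''); last by apply: ent_f; left.
  - by apply: In_all => g /D''P[/(all_In wfD)].
  - by move=> g gD'; apply: ent_f; right.
  - by move=> g /D''P[].
  apply: (@entailed_consistent _ (f :: D')) => // p cs.
    by move=> sz_cs ent; apply/D''P; split=> //; apply: ent_D.
  by move=> /D''P[].
(* Conversely, a consistent subset of [D] containing [D'] and [f] is itself a model of [f :: D'], so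
   it contains the entailed fact, which was outside [D]. *)
move=> D'' _ subD' subD'' consD'' f fD''; apply: NNPP => nfD'.
have [p [h [/certain_pred_query ent nD]]] := maxD' f (subD'' f fD'') nfD'.
have [|pb /= r] := ent (db_struct D'').
  by apply: db_struct_model => // g [<-|/subD'].
by apply: nD; apply: subD''; rewrite map_id in r.
Qed.
End Definability.

(** * Repair checking is first-order definable *)

Section RepairFormula.
Variable S : signature.
Implicit Types (D : database S).

Definition subset_pfo : pfo S :=
  PAll [seq PNot (PClose (PAnd (PTuple false p (pred_vars p))
                               (PNot (PTuple true p (pred_vars p)))))
       | p <- enum (sym S)].

(** Well-formedness of [D'] gives each of its facts the length of [pred_vars p], so quantifying over
    these variables reaches it. *)
Lemma subset_pfoP D D' u : wf_db D' ->
  pholds D D' u subset_pfo <-> db_subset D' D.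
Proof.
move=> wfD'; rewrite pholds_all; split=> [all_p [p cs] fD'|sub phi].
  apply: NNPP => nfD.
  have /andP[/eqP /= sz_cs _] := all_In wfD' fD'.
  have in_l : List.In p (enum (sym S)) by apply/In_mem; rewrite mem_enum.
  apply: (all_p _ (proj2 (In_map _ _ _) (ex_intro2 _ _ p in_l erefl))).
  apply/pholds_close; exists (nth 0 cs).
  by rewrite /= -map_comp /pred_vars -sz_cs -/(mkseq _ _) mkseq_nth.
by move=> /In_map[p _ ->] /pholds_close[w [inD' nD]]; apply: nD; apply: sub.
Qed.

Definition lit_pfo (l : literal S) : pfo S :=
  match l with
  | LAtom a => PAtom false (apred a) (aargs a)
  | LNeq t t' => PNot (PEq S t t')
  end.

Definition conj_pfo (g : conj S) : pfo S := PAll (map lit_pfo g).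

(** [bot] is false in every structure and absent from a well-formed database, so membership alone
    decides an atom. *)
Lemma conj_pfoP D D' u g : wf_db D' ->
  pholds D D' u (conj_pfo g) <-> conj_holds (M := db_struct D') u g.
Proof.
move=> wfD'.
have lit_pfoP l : pholds D D' u (lit_pfo l) <-> lit_holds (M := db_struct D') u l.
  case: l => [a|t t'] //; split=> [ina|[]] //; split=> //.
  by apply/eqP; have /andP[] := all_In wfD' ina.
rewrite pholds_all; split=> [H l lg|H phi /In_map[l lg ->]].
  by apply/lit_pfoP; apply: H; apply/In_map; exists l.
by apply/lit_pfoP; apply: H.
Qed.

Definition head_conj (d : dependency S) : conj S :=
  if dhead d is q :: _ then cq_body q else [::].

Definition dep_pfo (d : dependency S) : pfo S :=
  PNot (PClose (PAnd (conj_pfo (dbody d)) (PNot (conj_pfo (head_conj d))))).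

(** A full head has no quantified variables, so it is evaluated under the valuation of the body, and
    a violation is a single existential statement. *)
Lemma dep_pfoP D D' u d : wf_db D' -> full d ->
  pholds D D' u (dep_pfo d) <-> dep_holds (db_struct D') d.
Proof.
move=> wfD'; rewrite /full /dep_pfo /head_conj /dep_holds.
case: (dhead d) => [|q [|//]] // /andP[/eqP ex_q _].
have headP v : cq_holds (M := db_struct D') v q <->
    conj_holds (M := db_struct D') v (cq_body q).
  split=> [[w [ew Hw]]|Hv]; last by exists v.
  suff -> : v = w by [].
  by apply: functional_extensionality => z; rewrite ew // ex_q.
split=> [H v body_v|H /pholds_close[w [/(conj_pfoP _ _ _ wfD') body_w nw]]].
  exists q; [by left|apply/headP/(conj_pfoP D v _ wfD'); apply: NNPP => nv].
  by apply: H; apply/pholds_close; exists v; split=> //; apply/conj_pfoP.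
by apply: nw; apply/conj_pfoP => //; have [q' [<-|//] /headP] := H w body_w.
Qed.

Fixpoint tuple_eq (ts us : seq term) : pfo S :=
  match ts, us with
  | [::], [::] => PAll [::]
  | t :: ts', t' :: us' => PAnd (PEq S t t') (tuple_eq ts' us')
  | _, _ => PNot (PAll [::])
  end.

Lemma tuple_eqP D D' u ts us :
  pholds D D' u (tuple_eq ts us) <-> map (term_val u) ts = map (term_val u) us.
Proof.
elim: ts us => [|t ts IHts] [|t' us] /=.
- by [].
- by split=> // /(_ erefl).
- by split=> // /(_ erefl).
by rewrite IHts; split=> [[-> ->]|[-> ->]].
Qed.

Definition por (a b : pfo S) : pfo S := PNot (PAnd (PNot a) (PNot b)).

Lemma por_holds D D' u a b :
  pholds D D' u (por a b) <-> pholds D D' u a \/ pholds D D' u b.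
Proof. by rewrite /=; split; [move=> ?; apply: NNPP|]; tauto. Qed.

(* [phi] relativised to the second database extended by the fact [p(xs)]. *)
Fixpoint add_fact (p : sym S) (xs : seq nat) (phi : fo S) : pfo S :=
  match phi with
  | FAtom a =>
      if apred a == p then
        por (tuple_eq (aargs a) (map TVar xs)) (PAtom false (apred a) (aargs a))
      else PAtom false (apred a) (aargs a)
  | FEq t t' => PEq S t t'
  | FNot a => PNot (add_fact p xs a)
  | FAnd a b => PAnd (add_fact p xs a) (add_fact p xs b)
  | FEx y a => PEx y (add_fact p xs a)
  end.

Fixpoint fo_bound (phi : fo S) : nat :=
  match phi with
  | FAtom _ | FEq _ _ => 0
  | FNot a => fo_bound a
  | FAnd a b => maxn (fo_bound a) (fo_bound b)
  | FEx y a => maxn y.+1 (fo_bound a)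
  end.

(** [fo_bound phi] exceeds all quantified variables of [phi], so no quantifier changes the values of
    [xs] and the added fact is the same in all subformulas. *)
Lemma add_factP D D' p xs phi u :
  (forall z, z \in xs -> fo_bound phi <= z) ->
  wf_db (Fact p (map u xs) :: D') ->
  pholds D D' u (add_fact p xs phi) <->
  fo_holds (M := db_struct (Fact p (map u xs) :: D')) u phi.
Proof.
elim: phi u => [a|t t'|phi IH|phi IH psi IH'|y phi IH] u fresh wfE //.
- have -> : fo_holds (M := db_struct (Fact p (map u xs) :: D')) u (FAtom a) <->
      List.In (Fact (apred a) (map (term_val u) (aargs a))) (Fact p (map u xs) :: D').
    split=> [[]//|ina]; split=> //.
    by apply/eqP; have /andP[] := all_In wfE ina.
  rewrite [add_fact _ _ _]/=; case: eqP => [->|ne].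
    rewrite por_holds tuple_eqP -map_comp /=.
    by split=> -[e|]; [left; rewrite e|right|left; case: e|right].
  by rewrite /=; split=> [|[[/esym]|]] //; right.
- by rewrite /= IH.
- rewrite /= IH ?IH' // => z /fresh /=; rewrite geq_max => /andP[] //.
have upd_xs e : map (upd u y e) xs = map u xs.
  apply/eq_in_map => z /fresh /=; rewrite geq_max => /andP[lt_y _].
  by rewrite /upd; case: eqP => // zy; rewrite zy ltnn in lt_y.
have IHe e : pholds D D' (upd u y e) (add_fact p xs phi) <->
    fo_holds (M := db_struct (Fact p (map u xs) :: D')) (upd u y e) phi.
  rewrite -(upd_xs e); apply: IH; rewrite ?upd_xs // => z /fresh /=.
  by rewrite geq_max => /andP[].
by split=> -[e He]; exists e; apply/IHe.
Qed.

Lemma map_nth_shift N cs : map (fun z => nth 0 cs (z - N)) (iota N (size cs)) = cs.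
Proof.
rewrite -[X in iota X]addn0 iotaDl -map_comp -[RHS](mkseq_nth 0) /mkseq.
by apply: eq_map => z /=; rewrite addKn.
Qed.

Section Rewriting.
Variables (Sig : seq (dependency S)) (phi_ : sym S -> fo S).
Hypothesis phiP : forall p D h, wf_db D ->
  certain Sig D (pred_query p) h <-> fo_holds (M := db_struct D) h (phi_ p).

(** Variables of the added fact start here, so that they meet neither [pred_vars r] nor a quantifier
    of [phi_ r], for any [r]. *)
Definition fresh_var : nat :=
  \max_(p : sym S) maxn (arity p) (fo_bound (phi_ p)).

Definition new_vars (p : sym S) : seq nat := iota fresh_var (arity p).

(** The maximality condition of [repairP] for the facts over the predicate [p]. *)
Definition max_pfo (p : sym S) : pfo S :=
  PNot (PClose (PAnd (PTuple true p (new_vars p))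
    (PAnd (PNot (PTuple false p (new_vars p)))
      (PAll [seq PNot (PExs (pred_vars r)
                   (PAnd (add_fact p (new_vars p) (phi_ r))
                         (PNot (PTuple true r (pred_vars r)))))
            | r <- enum (sym S)])))).

Lemma fresh_varP p : arity p <= fresh_var /\ fo_bound (phi_ p) <= fresh_var.
Proof.
have := leq_bigmax (F := fun p => maxn (arity p) (fo_bound (phi_ p))) p.
by rewrite geq_max => /andP.
Qed.

Lemma escapeP D D' p u : wf_db (Fact p (map u (new_vars p)) :: D') ->
  (exists r h, certain Sig (Fact p (map u (new_vars p)) :: D') (pred_query r) h /\
               ~ List.In (Fact r (map h (pred_vars r))) D) <->
  exists r, pholds D D' u (PExs (pred_vars r)
    (PAnd (add_fact p (new_vars p) (phi_ r)) (PNot (PTuple true r (pred_vars r))))).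
Proof.
move=> wfE.
have new_agree (r : sym S) w : (forall z, z \notin pred_vars r -> w z = u z) ->
    map w (new_vars p) = map u (new_vars p).
  move=> ew; apply/eq_in_map => z; rewrite mem_iota => /andP[le_z _]; apply: ew.
  by rewrite mem_iota /= add0n -leqNgt (leq_trans (proj1 (fresh_varP r))).
have fresh r z : z \in new_vars p -> fo_bound (phi_ r) <= z.
  by rewrite mem_iota => /andP[le_z _]; apply: leq_trans (proj2 (fresh_varP r)) le_z.
have bodyP (r : sym S) w : (forall z, z \notin pred_vars r -> w z = u z) ->
    pholds D D' w (PAnd (add_fact p (new_vars p) (phi_ r))
                        (PNot (PTuple true r (pred_vars r)))) <->
    certain Sig (Fact p (map u (new_vars p)) :: D') (pred_query r) w /\
    ~ List.In (Fact r (map w (pred_vars r))) D.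
  move=> ew; have := @add_factP D D' p (new_vars p) (phi_ r) w (fresh r).
  rewrite (new_agree r w ew) => /(_ wfE) addP.
  by rewrite phiP // -addP /= -map_comp.
split=> -[r]; last first.
  by move=> /pholds_exs[w ew /(bodyP r w ew)]; exists r, w.
move=> [h [cert nD]]; exists r; apply/pholds_exs.
(* Certainty of the atomic query depends only on the values at [pred_vars r], so [h] may be replaced
   by [u] elsewhere; this preserves the added fact, whose variables are disjoint from those. *)
pose w z := if z \in pred_vars r then h z else u z.
have ew z : z \notin pred_vars r -> w z = u z by rewrite /w => /negPf ->.
have eh : map w (pred_vars r) = map h (pred_vars r).
  by apply/eq_in_map => z zr; rewrite /w zr.
exists w => //; apply/bodyP; rewrite // eh; split=> //.
by apply/certain_pred_query; rewrite eh; apply/certain_pred_query.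
Qed.

Lemma max_pfoP D D' u : wf_db D -> wf_db D' ->
  (forall p, pholds D D' u (max_pfo p)) <->
  forall f, List.In f D -> ~ List.In f D' ->
    exists r h, certain Sig (f :: D') (pred_query r) h /\
                ~ List.In (Fact r (map h (pred_vars r))) D.
Proof.
move=> wfD wfD'; split=> [all_p [p cs] fD nfD'|esc p].
  have /andP[/eqP /= sz_cs _] := all_In wfD fD.
  (* The list [new_vars p] starts at [fresh_var], hence the shift. *)
  pose w z := nth 0 cs (z - fresh_var).
  have ew : map w (new_vars p) = cs by rewrite /new_vars -sz_cs map_nth_shift.
  have wfE : wf_db (Fact p (map w (new_vars p)) :: D').
    by rewrite /wf_db /= ew (all_In wfD fD).
  rewrite -ew; apply/(escapeP D wfE); apply: NNPP => no_r.
  apply: (all_p p); apply/pholds_close; exists w; split.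
    by apply/pholds_tuple; rewrite ew.
  split; first by move=> /pholds_tuple; rewrite ew.
  by apply/pholds_all => psi /In_map[r _ ->] Hr; apply: no_r; exists r.
move=> /pholds_close[w [inD [nfD' /(proj1 (pholds_all D D' w _)) all_r]]].
have fD := proj1 (pholds_tuple D D' w true p (new_vars p)) inD.
have wfE : wf_db (Fact p (map w (new_vars p)) :: D').
  by rewrite /wf_db /= (all_In wfD fD).
have [|r Hr] := proj1 (escapeP D wfE) (esc _ fD _).
  by move=> fD'; apply: nfD' (proj2 (pholds_tuple D D' w false p (new_vars p)) fD').
apply: all_r (PNot _) _ Hr; apply/In_map; exists r => //.
by apply/In_mem; rewrite mem_enum.
Qed.

Definition repair_pfo : pfo S :=
  PAnd subset_pfo (PAnd (PAll (map dep_pfo Sig)) (PAll (map max_pfo (enum (sym S))))).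

Lemma repair_pfoP D D' u : all (@wf_dep S) Sig -> all (@full S) Sig ->
  wf_db D -> wf_db D' ->
  pholds D D' u repair_pfo <-> is_repair Sig D D'.
Proof.
move=> wfSig fullSig wfD wfD'; rewrite repairP //.
have consP : pholds D D' u (PAll (map dep_pfo Sig)) <-> consistent Sig D'.
  rewrite pholds_all; split=> [H d dSig|H phi /In_map[d dSig ->]].
    apply/(dep_pfoP D u wfD' (all_In fullSig dSig)).
    by apply: H; apply/In_map; exists d.
  by apply/dep_pfoP; [|apply: all_In dSig|apply: H].
have maxP : pholds D D' u (PAll (map max_pfo (enum (sym S)))) <->
    forall p, pholds D D' u (max_pfo p).
  rewrite pholds_all; split=> [H p|H phi /In_map[p _ ->]] //.
  by apply: H; apply/In_map; exists p => //; apply/In_mem; rewrite mem_enum.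
rewrite [pholds _ _ _ repair_pfo]/= -[pholds _ _ _ (foldr _ _ _)]/(pholds D D' u subset_pfo).
rewrite subset_pfoP // consP maxP max_pfoP //.
by split=> [[? [? ?]]|[]].
Qed.

End Rewriting.
End RepairFormula.

Theorem theorem6 (S : signature) (Sig : seq (dependency S)) :
  all (@wf_dep S) Sig ->
  all (@full S) Sig ->
  CQ_FO_rewritable Sig ->
  in_AC0 (fun DD : database S * database S => wf_db DD.1 /\ wf_db DD.2)
         (@enc_pair S)
         (fun DD => is_repair Sig DD.1 DD.2).
Proof.
move=> wfSig fullSig rew.
(* Rewritings of the atomic queries are chosen for all predicates at once, the signature being
   finite. *)
have [phi_ phiP] := fin_all_exists (fun p => rew (pred_query p) (wf_pred_query p)).
apply: (@pfo_in_AC0 _ _ _ (repair_pfo Sig phi_)) => D D' u [wfD wfD'].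
by apply: repair_pfoP => // p E h wfE; have [_ [_]] := phiP p; apply.
Qed.
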